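(* Let $K\subset\mathbb{R}^d$ be compact, $\mathbf p$ a Borel probability measure on $\mathcal P(K)$, $\lambda\ge0$, $n,N\in\mathbb{N}$, $\mathcal V_n$ an $n$-dimensional space of cylinder functions on $\mathcal P(K)$, $\{\ell_1,\dots,\ell_n\}$ a basis of $\mathcal V_n$ orthonormal in $L^2(\mathcal P(K),\mathbf p)$ with $\mathrm{pCE}_{2,\mathbf p}(\ell_i,\ell_j)=0$ for $i\neq j$, and $\mu_1,\dots,\mu_N$ i.i.d. with law $\mathbf p$, $\mathbf p_N:=\frac1N\sum_{j=1}^N\delta_{\mu_j}$. Let $M>0$ and $F:\mathcal P(K)\to[-M,M]$ measurable, and let $F^\star:=-M\vee S_N^{\lambda,n}(F)\wedge M$. Let $r>0$ and suppose $N\ge2$ and \[\frac{N}{\log N}\ge\frac{(1+r)K_\lambda(n)}{\sigma^\lambda_{\min,n}\,c_{1/(2\sigma^\lambda_{\max,n})}}.\] Then \[\mathbb E\big[\|F-F^\star\|^2_{L^2(\mathcal P(K),\mathbf p)}\big]\le 2e(F,n)\Big(1+\frac{c_{1/2}}{\log(N)(1+r)(1/2+\lambda\mu_{\min,n})^2}\Big)+4\lambda\,\mathrm{pCE}_{2,\mathbf p}(P_nF)+2M^2N^{-r},\] where $P_nF$ is the $L^2(\mathcal P(K),\mathbf p)$-orthogonal projection of $F$ onto $\mathcal V_n$, $e(F,n):=\|P_nF-F\|^2_{L^2(\mathcal P(K),\mathbf p)}$ and $\mu_{\min,n}:=\min_{i}\mathrm{pCE}_{2,\mathbf p}(\ell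_i)$.
   Context: $\mathcal P(K)$: Borel probability measures on $K$ with the 2-Wasserstein distance. A cylinder function is $G=\psi\circ L_{\boldsymbol\phi}$ with $L_{\boldsymbol\phi}(\mu)=(\int\phi_1d\mu,\dots,\int\phi_md\mu)$, $\psi\in C^1_b(\mathbb{R}^m)$, $\phi_i\in C^1_b$; ${\rm D}G(\mu,x)=\sum_i\partial_i\psi(L_{\boldsymbol\phi}(\mu))\nabla\phi_i(x)$. For a measure $\mathbf n$ on $\mathcal P(K)$: $\mathrm{pCE}_{2,\mathbf n}(G,H):=\int\int_K{\rm D}G(\mu,x)\cdot{\rm D}H(\mu,x)\,d\mu(x)\,d\mathbf n(\mu)$ and $\mathrm{pCE}_{2,\mathbf n}(G):=\mathrm{pCE}_{2,\mathbf n}(G,G)$. $S_N^{\lambda,n}(F)$ denotes the minimizer over $G\in\mathcal V_n$ of $\|F-G\|^2_{L^2(\mathcal P(K),\mathbf p_N)}+\lambda\,\mathrm{pCE}_{2,\mathbf p_N}(G)$. $a\vee b=\max$, $a\wedge b=\min$. $K_\lambda(n):=\sup_{\mu\in\mathcal P(K)}\sum_{i=1}^n\big(|\ell_i(\mu)|^2+\lambda\int_K|{\rm D}\ell_i(\mu,x)|^2d\mu(x)\big)$; $\sigma^\lambda_{\min,n}:=1+\lambda\min_i\mathrm{pCE}_{2,\mathbf p}(\ell_i)$; $\sigma^\lambda_{\max,n}:=1+\lambda\max_i\mathrm{pCE}_{2,\mathbf p}(\ell_i)$; $c_\delta:=(1+\delta)\log(1+\delta)-\delta$. *)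

(* Defs.v *)
From HB Require Import structures.
From mathcomp Require Import all_boot all_order all_algebra.
From mathcomp Require Import all_classical all_reals all_analysis giry.
Set Implicit Arguments. Unset Strict Implicit. Unset Printing Implicit Defensive.
Import Order.TTheory GRing.Theory Num.Theory.
Import numFieldNormedType.Exports.
Local Open Scope classical_set_scope.
Local Open Scope ring_scope.

Section Defs.
Variables (R : realType) (d : nat).

Definition Rd : Type := g_sigma_algebraType (@open 'rV[R]_d).

(* Subprobability measures on R^d, with the Giry (evaluation) sigma-algebra. *)
Definition MeasRd : Type := giry Rd R.

Definition PK (K : set 'rV[R]_d) : set MeasRd :=
  [set mu | mu [set: Rd] = 1%E /\ mu (~` (K : set Rd)) = 0%E].

Definition pd {m : nat} (f : 'rV[R]_m -> R) (i : 'I_m) (x : 'rV[R]_m) : R :=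
  'D_(delta_mx 0 i) f x.

Definition grad {m : nat} (f : 'rV[R]_m -> R) (x : 'rV[R]_m) : 'rV[R]_m :=
  \row_j pd f j x.

Definition C1b {m : nat} (f : 'rV[R]_m -> R) : Prop :=
  continuous f /\ (exists C : R, forall x, `|f x| <= C) /\
  forall i : 'I_m, (forall x, derivable f x (delta_mx 0 i)) /\
    continuous (pd f i) /\ (exists C : R, forall x, `|pd f i x| <= C).

Definition dotv (u v : 'rV[R]_d) : R := \sum_(j < d) u 0 j * v 0 j.
Definition sqnorm (u : 'rV[R]_d) : R := dotv u u.

(* A cylinder function G = psi o L_phi, given through its representation. *)
Record cylinder := Cylinder {
  cyl_m : nat;
  cyl_psi : 'rV[R]_cyl_m -> R;
  cyl_phi : 'I_cyl_m -> 'rV[R]_d -> R;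
  cyl_psiC : C1b cyl_psi;
  cyl_phiC : forall k, C1b (cyl_phi k) }.
Arguments cyl_psi : clear implicits.
Arguments cyl_phi : clear implicits.

Definition cyl_L (G : cylinder) (mu : MeasRd) : 'rV[R]_(cyl_m G) :=
  \row_k Rintegral mu [set: Rd] (cyl_phi G k : Rd -> R).

Definition cyl_eval (G : cylinder) (mu : MeasRd) : R := cyl_psi G (cyl_L G mu).

Definition cyl_D (G : cylinder) (mu : MeasRd) (x : 'rV[R]_d) : 'rV[R]_d :=
  \sum_(k < cyl_m G) pd (cyl_psi G) k (cyl_L G mu) *: grad (cyl_phi G k) x.

(* Elements of V_n = span(l_1..l_n), given by coefficient vectors. *)
Definition vn_eval {n} (l : 'I_n -> cylinder) (c : 'I_n -> R) (mu : MeasRd) : R :=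
  \sum_(i < n) c i * cyl_eval (l i) mu.
Definition vn_D {n} (l : 'I_n -> cylinder) (c : 'I_n -> R) (mu : MeasRd)
  (x : 'rV[R]_d) : 'rV[R]_d :=
  \sum_(i < n) c i *: cyl_D (l i) mu x.

End Defs.

Section Defs2.
Variables (R : realType) (d : nat).
Local Open Scope ring_scope.
Local Notation MeasRd := (MeasRd R d).

Definition innerCE (K : set 'rV[R]_d) (DG DH : MeasRd -> 'rV[R]_d -> 'rV[R]_d)
  (mu : MeasRd) : R :=
  Rintegral mu (K : set (Rd R d)) (fun x : Rd R d => dotv (DG mu x) (DH mu x)).

Definition pCE_p (K : set 'rV[R]_d) (p : probability MeasRd R)
  (DG DH : MeasRd -> 'rV[R]_d -> 'rV[R]_d) : R :=
  Rintegral p (PK K) (innerCE K DG DH).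

Definition pCE_emp (K : set 'rV[R]_d) (N : nat) (mus : 'I_N -> MeasRd)
  (DG : MeasRd -> 'rV[R]_d -> 'rV[R]_d) : R :=
  N%:R^-1 * \sum_(j < N) innerCE K DG DG (mus j).

Definition L2_emp (N : nat) (mus : 'I_N -> MeasRd) (F G : MeasRd -> R) : R :=
  N%:R^-1 * \sum_(j < N) (F (mus j) - G (mus j)) ^+ 2.

Definition cdelta (delta : R) : R := (1 + delta) * ln (1 + delta) - delta.

Definition Klam (K : set 'rV[R]_d) {n : nat} (l : 'I_n -> cylinder R d)
  (lam : R) : R :=
  sup [set \sum_(i < n) (cyl_eval (l i) mu ^+ 2
                         + lam * innerCE K (cyl_D (l i)) (cyl_D (l i)) mu)
      | mu in PK K].

Definition L2ip (K : set 'rV[R]_d) (p : probability MeasRd R) (F G : MeasRd -> R) : R :=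
  Rintegral p (PK K) (fun mu => F mu * G mu).

(* coefficients of the L^2(p)-orthogonal projection P_n F onto V_n
   w.r.t. the L^2(p)-orthonormal basis l *)
Definition proj_coef (K : set 'rV[R]_d) (p : probability MeasRd R) {n : nat}
  (l : 'I_n -> cylinder R d) (F : MeasRd -> R) : 'I_n -> R :=
  fun i => L2ip K p F (cyl_eval (l i)).

Definition clip (M x : R) : R := Num.min (Num.max (- M) x) M.
End Defs2.

(* Main.v *)
Require Import Defs.
From HB Require Import structures.
From mathcomp Require Import all_boot all_order all_algebra.
From mathcomp Require Import all_classical all_reals all_analysis giry.
From mathcomp Require Import measurable_realfun.
From mathcomp Require Import ring lra zify.
Import Order.TTheory GRing.Theory Num.Theory.
Import numFieldNormedType.Exports.
Local Open Scope classical_set_scope.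
Local Open Scope ring_scope.

(** On the event that the empirical Gram matrix
    [H_N = 1/N sum_j (l_i l_k + lam <D l_i, D l_k>)(mu_j)] dominates
    [s = 1/2 + lam mu_min], testing the minimality of [S_N F] in the direction
    [u = S_N F - P_n F] gives [u^T H_N u <= eta.u - lam a^T A_N u] ([eta] the empirical
    correlation of [F - P_n F] with the basis, [A_N] the empirical energy matrix, [a] the
    coordinates of [P_n F]), and Young's inequality yields
    [|u|^2 <= 2 |eta|^2 / s^2 + 4 lam a^T A_N a], whose expectation is explicit.
    Off that event [|F - F^*|^2 <= 4 M^2], and its probability is controlled by a lower-tail
    matrix Chernoff bound. The latter is proved without matrix exponentials or the
    Golden-Thompson inequality: with [W = I - eps sum_j X_j] and [a_m = E tr W^m], one has
    [a_(m+1) = a_m - eps sum_j E tr (X_j W^m)], and if [W'_j = W + eps X_j] is the matrix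
    without the [j]-th summand, then [tr (X_j W^m)] is compared to [tr (X_j W'_j^m)], where
    independence applies. This loses only the factor [1 - O(eps m)], and gives the exponent
    [N delta^2 / (2 c)], which dominates [N c_delta / c]. *)

(** The Gram matrices have mean [diag (sigma i)], so they are conjugated to mean identity before the
    Chernoff bound is applied. The relative deviation [delta = 1 / (2 sigma_max)] then costs
    [sigma i / (2 sigma_max) <= 1/2] in direction [i], which is the origin of the [1/2] in [s].
    After this rescaling a summand is at most [c = K / sigma_min], and [c_delta <= delta^2 / 2]
    turns the condition on [N] into an exponent of at least [(1 + r) log N]. This is a factor
    [1 / N] better than the claim asks for, and that factor pays for the dimension [n] in the trace
    bound, because the same condition forces [n <= N / 4]. By convexity of [c_delta] the condition
    also controls the variance factor [K / N]. The minimizers are given sample by sample, without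
    measurability. Hence the error is never manipulated as a random variable: at every sample it is
    dominated by one explicit bounded measurable function, into which each bad event enters through
    a nonnegative function that is at least 1 on it. *)

Set Implicit Arguments.
Unset Strict Implicit.
Unset Printing Implicit Defensive.

(** * Positive semidefinite matrices *)

Section PSD.
Variables (R : realFieldType) (n : nat).
Implicit Types (A B W X : 'M[R]_n) (u v : 'rV[R]_n).

Definition bform A u v : R := (u *m A *m v^T) 0 0.

Definition psd A : Prop := A^T = A /\ forall v, 0 <= bform A v v.

Lemma bformDl A u1 u2 v : bform A (u1 + u2) v = bform A u1 v + bform A u2 v.
Proof. by rewrite /bform !mulmxDl mxE. Qed.

Lemma bformZl A a u v : bform A (a *: u) v = a * bform A u v.
Proof. by rewrite /bform -!scalemxAl mxE. Qed.

Lemma bformDr A u v1 v2 : bform A u (v1 + v2) = bform A u v1 + bform A u v2.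
Proof. by rewrite /bform linearD mulmxDr mxE. Qed.

Lemma bformZr A a u v : bform A u (a *: v) = a * bform A u v.
Proof. by rewrite /bform linearZ -scalemxAr mxE. Qed.

Lemma bformC A u v : A^T = A -> bform A u v = bform A v u.
Proof.
move=> sA; rewrite /bform -[in RHS]sA.
have -> : v *m A^T *m u^T = (u *m A *m v^T)^T by rewrite !trmx_mul trmxK mulmxA.
by rewrite [RHS]mxE.
Qed.

Lemma bformE A u v : bform A u v = \sum_i \sum_k u 0 i * A i k * v 0 k.
Proof.
rewrite /bform mxE exchange_big; apply: eq_bigr => k _ /=.
by rewrite !mxE mulr_suml.
Qed.

Lemma bformMD A B u v : bform (A + B) u v = bform A u v + bform B u v.
Proof. by rewrite /bform mulmxDr mulmxDl mxE. Qed.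

Lemma bformMZ a A u v : bform (a *: A) u v = a * bform A u v.
Proof. by rewrite /bform -scalemxAr -scalemxAl mxE. Qed.

Lemma bformMN A u v : bform (- A) u v = - bform A u v.
Proof. by rewrite -scaleN1r bformMZ mulN1r. Qed.

Lemma bform_scalar a u v : bform a%:M u v = a * bform 1%:M u v.
Proof. by rewrite -bformMZ scalemx1. Qed.

Lemma bform1 u v : bform 1%:M u v = \sum_i u 0 i * v 0 i.
Proof. by rewrite /bform mulmx1 mxE; apply: eq_bigr => i _; rewrite mxE. Qed.

Lemma psdD A B : psd A -> psd B -> psd (A + B).
Proof.
move=> [sA pA] [sB pB]; split; first by rewrite linearD /= sA sB.
by move=> v; rewrite bformMD addr_ge0.
Qed.

Lemma psdZ a A : 0 <= a -> psd A -> psd (a *: A).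
Proof.
move=> a0 [sA pA]; split; first by rewrite linearZ /= sA.
by move=> v; rewrite bformMZ mulr_ge0.
Qed.

Lemma psd0 : psd 0.
Proof. by split; [rewrite trmx0|move=> v; rewrite /bform mulmx0 mul0mx mxE]. Qed.

Lemma psd_sum (I : Type) (s : seq I) (P : pred I) (F : I -> 'M[R]_n) :
  (forall i, P i -> psd (F i)) -> psd (\sum_(i <- s | P i) F i).
Proof. by move=> h; elim/big_ind: _ => //; [exact: psd0|exact: psdD]. Qed.

Lemma psd_scalar a : 0 <= a -> psd a%:M.
Proof.
move=> a0; split; first by rewrite tr_scalar_mx.
move=> v; rewrite bform_scalar bform1 mulr_ge0// sumr_ge0// => i _.
by rewrite -expr2 sqr_ge0.
Qed.

Lemma psd_conj A (C : 'M[R]_n) : psd A -> psd (C^T *m A *m C).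
Proof.
move=> [sA pA]; split; first by rewrite !trmx_mul trmxK sA mulmxA.
by move=> v; have := pA (v *m C^T); rewrite /bform trmx_mul trmxK !mulmxA.
Qed.

Lemma psd_cauchy_schwarz A u v : psd A ->
  bform A u v ^+ 2 <= bform A u u * bform A v v.
Proof.
move=> [sA pA].
have H (t : R) : 0 <= bform A u u + 2 * t * bform A u v + t ^+ 2 * bform A v v.
  have := pA (u + t *: v).
  rewrite bformDl !bformDr !bformZl !bformZr (bformC v u sA).
  by congr (0 <= _); ring.
have [v0|vN0] := eqVneq (bform A v v) 0.
  rewrite v0 mulr0; have [->|b0] := eqVneq (bform A u v) 0; first by rewrite expr0n.
  (* With [bform A v v = 0] the quadratic is affine in [t]; this [t] gives it the value -1. *)
  have := H (- (bform A u u + 1) / (2 * bform A u v)).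
  rewrite v0; set a := bform A u u; set b := bform A u v.
  have -> : a + 2 * (- (a + 1) / (2 * b)) * b +
     (- (a + 1) / (2 * b)) ^+ 2 * 0 = -1 by field.
  by rewrite lerNr oppr0 ler10.
have vp : 0 < bform A v v by rewrite lt_neqAle eq_sym vN0 pA.
have := H (- bform A u v / bform A v v).
set a := bform A u u; set b := bform A u v; set c := bform A v v.
have -> : a + 2 * (- b / c) * b + (- b / c) ^+ 2 * c = (a * c - b ^+ 2) / c by field.
by rewrite pmulr_lge0 ?invr_gt0// subr_ge0.
Qed.

Lemma bform_delta A i k : bform A (delta_mx 0 i) (delta_mx 0 k) = A i k.
Proof. by rewrite /bform trmx_delta -rowE -colE !mxE. Qed.

Lemma psd_diag_ge0 A i : psd A -> 0 <= A i i.
Proof. by move=> [_ pA]; rewrite -bform_delta. Qed.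

Lemma psd_trace_ge0 A : psd A -> 0 <= \tr A.
Proof. by move=> pA; apply: sumr_ge0 => i _; exact: psd_diag_ge0. Qed.

(* Symmetric elimination: subtracting the rank-one matrix carried by a nonzero
   diagonal entry keeps the matrix positive and lowers the number of such entries. *)
Lemma psd_mul_trace_ge0 A B : psd A -> psd B -> 0 <= \tr (A *m B).
Proof.
move=> + pB; have [k] := ubnP #|[pred i | A i i != 0]|.
elim: k A => // k IH A; rewrite ltnS => cA pA.
have [/existsP[i Ai]|/existsPn nA] := boolP [exists i, A i i != 0]; last first.
  suff -> : A = 0 by rewrite mul0mx mxtrace0.
  apply/matrixP => i j; rewrite mxE; apply/eqP; rewrite -sqrf_eq0 eq_le sqr_ge0 andbT.
  have := @psd_cauchy_schwarz A (delta_mx 0 i) (delta_mx 0 j) pA.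
  by rewrite !bform_delta (eqP (negPn (nA i))) mul0r.
have Aip : 0 < A i i by rewrite lt_neqAle eq_sym Ai psd_diag_ge0.
pose e : 'rV[R]_n := delta_mx 0 i.
pose A' := A - (A i i)^-1 *: ((e *m A)^T *m (e *m A)).
have pA' : psd A'.
  split; first by rewrite linearB linearZ /= trmx_mul trmxK (proj1 pA).
  move=> v; rewrite /A' bformMD -scaleNr bformMZ.
  have -> : bform ((e *m A)^T *m (e *m A)) v v = bform A v e ^+ 2.
    have -> : bform A v e = (v *m (e *m A)^T) 0 0.
      by rewrite trmx_mul (proj1 pA) mulmxA.
    rewrite /bform; move: (e *m A) => x.
    have -> : v *m (x^T *m x) *m v^T = (v *m x^T) *m (v *m x^T)^T.
      by rewrite trmx_mul trmxK !mulmxA.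
    by rewrite mxE big_ord1 [X in _ * X]mxE expr2.
  have := @psd_cauchy_schwarz A v e pA; rewrite bform_delta => H.
  by rewrite mulNr subr_ge0 mulrC ler_pdivrMr.
have -> : \tr (A *m B) = \tr (A' *m B) + (A i i)^-1 * bform B (e *m A) (e *m A).
  rewrite /A' mulmxBl raddfB /= -scalemxAl mxtraceZ /bform.
  have E (x : 'rV[R]_n) : \tr (x^T *m x *m B) = (x *m B *m x^T) 0 0.
    by rewrite -mulmxA mxtrace_mulC /mxtrace big_ord1.
  by rewrite E subrK.
have A'E j : A' j j = A j j - (A i i)^-1 * A i j ^+ 2.
  rewrite /A' mxE [X in _ + X]mxE [X in - X]mxE; congr (_ - _ * _).
  by rewrite mxE big_ord1 [X in X * _]mxE -rowE mxE expr2.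
apply: addr_ge0; last by rewrite mulr_ge0 ?invr_ge0 ?(ltW Aip) // (proj2 pB).
apply: (IH _ _ pA'); apply: leq_trans cA; apply: proper_card; apply/fintype.properP; split.
  apply/fintype.subsetP => j; rewrite !inE; apply: contra => /eqP Aj.
  have d0 := psd_diag_ge0 j pA'.
  apply/eqP/le_anti; rewrite d0 andbT A'E Aj sub0r oppr_le0 mulr_ge0 ?sqr_ge0 //.
  by rewrite invr_ge0 ltW.
exists i; rewrite !inE // negbK A'E expr2 mulrA mulVf // mul1r subrr //.
Qed.

End PSD.

(** Increments of a convex sequence are nondecreasing: once a term exceeds [g 0], the sequence rises
    from there up to [m]. *)
Lemma convex_seq_le_max (R : realFieldType) (g : nat -> R) (m i : nat) :
  (forall j, (j.+2 <= m)%N -> 2 * g j.+1 <= g j + g j.+2) ->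
  (i <= m)%N -> g i <= Num.max (g 0%N) (g m).
Proof.
move=> gC; have inc k : (k < m)%N -> g k <= g 0%N \/ g k <= g k.+1.
  elim: k => [|k IH] km; first by left.
  have := gC k km; have [gk|gk] := IH (ltnW km); last by right; lra.
  by have [?|?] := leP (g k.+1) (g 0%N); [left|right; lra].
rewrite le_max; elim: m {gC}inc => [|m IH] inc; first by rewrite leqn0 => /eqP ->; rewrite lexx.
rewrite leq_eqVlt => /predU1P[->|]; first by rewrite lexx orbT.
rewrite ltnS => /IH/orP[k km|->//|gim].
  by apply: inc; rewrite ltnW.
have [gm|gm] := inc m (leqnn _); first by rewrite (le_trans gim).
by rewrite (le_trans gim gm) orbT.
Qed.

Section PSDpower.
Variables (R : realFieldType) (n : nat).
Implicit Types (A B W X : 'M[R]_n) (u v : 'rV[R]_n).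

Lemma psd_sandwich A X : X^T = X -> psd A -> psd (X * A * X).
Proof. by move=> sX pA; rewrite -{1}sX; exact: psd_conj. Qed.

(** Induction in steps of two, since [W ^+ m.+2] is [W ^+ m] sandwiched between two copies of
    [W]. *)
Lemma psd_exp W m : psd W -> psd (W ^+ m).
Proof.
move=> pW; have [k] := ubnP m; elim: k m => // k IH [|[|m]] mk.
- by apply: psd_scalar.
- by rewrite expr1.
- rewrite exprS exprSr mulrA; apply: psd_sandwich (proj1 pW) (IH _ _).
  by rewrite -ltnS ltnW.
Qed.

Lemma trmx_exp W m : psd W -> (W ^+ m)^T = W ^+ m.
Proof. by move=> pW; have [] := psd_exp m pW. Qed.

Lemma scaleMl a A B : a *: (A * B) = (a *: A) * B.
Proof. exact: scalemxAl. Qed.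

Lemma scaleMr a A B : a *: (A * B) = A * (a *: B).
Proof. exact: scalemxAr. Qed.

Lemma trmxM A B : (A * B)^T = B^T * A^T. Proof. exact: trmx_mul. Qed.

Lemma mxtraceB A B : \tr (A - B) = \tr A - \tr B. Proof. exact: raddfB. Qed.

Lemma mxtraceC A B : \tr (A * B) = \tr (B * A). Proof. exact: mxtrace_mulC. Qed.

Lemma psd_mxtraceM_ge0 A B : psd A -> psd B -> 0 <= \tr (A * B).
Proof. exact: psd_mul_trace_ge0. Qed.

(** Stands in for the bound of the largest eigenvalue by the trace. By Cauchy-Schwarz
    [|v|^2 I - v^T v] is positive, and the trace of its product with [A] is the difference of the
    two sides. *)
Lemma bform_le_trace A v : psd A -> bform A v v <= \tr A * bform 1%:M v v.
Proof.
move=> pA; have p1 : psd (1%:M : 'M[R]_n) by exact: psd_scalar.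
have pB : psd ((bform 1%:M v v)%:M - v^T *m v).
  split; first by rewrite linearB /= tr_scalar_mx trmx_mul trmxK.
  move=> u; rewrite bformMD bformMN subr_ge0 bform_scalar.
  have -> : bform (v^T *m v) u u = bform 1%:M u v ^+ 2.
    rewrite /bform mulmx1.
    have -> : u *m (v^T *m v) *m u^T = (u *m v^T) *m (u *m v^T)^T.
      by rewrite trmx_mul trmxK !mulmxA.
    by rewrite mxE big_ord1 [X in _ * X]mxE expr2.
  rewrite [leRHS]mulrC; exact: psd_cauchy_schwarz.
have := psd_mul_trace_ge0 pA pB.
rewrite mulmxBr raddfB /= subr_ge0 mul_mx_scalar mxtraceZ mulrC mulmxA mxtrace_mulC mulmxA.
by rewrite [X in X <= _]/mxtrace big_ord1.
Qed.

(** The moments [f k = <v, W^k v>] are log-convex by Cauchy-Schwarz, so their successive ratios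
    never fall below the first one, which is at least [w]. This is how one bad direction [v] makes
    the trace of a high power large. *)
Lemma trace_exp_ge W v (w : R) m : psd W -> 0 <= w -> 0 < bform 1%:M v v ->
  w * bform 1%:M v v <= bform W v v -> w ^+ m <= \tr (W ^+ m).
Proof.
move=> pW w0 v0 wv; pose f k := bform (W ^+ k) v v.
have f_ge0 k : 0 <= f k by exact: (proj2 (psd_exp k pW)).
have fCS k : f k.+1 ^+ 2 <= f k * f k.+2.
  have := psd_cauchy_schwarz v (v *m W) (psd_exp k pW).
  have -> : bform (W ^+ k) v (v *m W) = f k.+1.
    by rewrite /bform trmx_mul (proj1 pW) /f exprSr /bform -mulmxE !mulmxA.
  suff -> : bform (W ^+ k) (v *m W) (v *m W) = f k.+2 by [].
  by rewrite /bform trmx_mul (proj1 pW) /f exprSr exprS /bform -!mulmxE !mulmxA.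
have fS k : w * f k <= f k.+1.
  elim: k => [|k IH]; first by rewrite /f expr1.
  have [fk|fk] := eqVneq (f k.+1) 0; first by rewrite fk mulr0.
  have fk0 : 0 < f k.
    rewrite lt_neqAle f_ge0 andbT eq_sym; apply: contra fk => /eqP fk.
    by rewrite -sqrf_eq0 eq_le sqr_ge0 andbT; have := fCS k; rewrite fk mul0r.
  rewrite -(ler_pM2l fk0); apply: le_trans (fCS k).
  by rewrite mulrA (mulrC _ w) expr2 ler_wpM2r.
have fm : w ^+ m * f 0%N <= f m.
  elim: m => [|k IH]; first by rewrite mul1r.
  by rewrite exprS -mulrA (le_trans _ (fS k)) // ler_wpM2l.
have := le_trans fm (bform_le_trace v (psd_exp m pW)).
by rewrite /f expr0 ler_pM2r.
Qed.

Lemma trace_exp_lower W (w : R) m : psd W -> psd (W - w%:M) ->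
  w * \tr (W ^+ m) <= \tr (W ^+ m.+1).
Proof.
move=> pW pWw; have := psd_mxtraceM_ge0 pWw (psd_exp m pW).
by rewrite mulrBl raddfB /= -exprS subr_ge0 -mulmxE mul_scalar_mx mxtraceZ.
Qed.

(** * Effect on [tr (X W^m)] of adding [eps X] to [W] *)

Section TraceStep.
Variables (X W : 'M[R]_n) (eps c : R).
Hypotheses (eps0 : 0 <= eps) (c0 : 0 < c).
Hypotheses (pX : psd X) (pcX : psd (c%:M - X)) (pW : psd W).
Let W' := W + eps *: X.

Let pW' : psd W'. Proof. by apply: psdD => //; exact: psdZ. Qed.

Let sX : X^T = X := proj1 pX.
Let sW : W^T = W := proj1 pW.
Let sW' : W'^T = W' := proj1 pW'.

Let mulW' Z : Z * W' = Z * W + eps *: (Z * X).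
Proof. by rewrite /W' mulrDr scaleMr. Qed.

(** The price, up to the factor [eps], of exchanging one factor [W'] for [W] next to [X]; see
    [stepXE]. *)
Let G i j := \tr (X * W' ^+ i * X * W ^+ j).

Let G_ge0 i j : 0 <= G i j.
Proof. by apply: psd_mxtraceM_ge0; [apply: psd_sandwich => //|]; exact: psd_exp. Qed.

Let stepXE i j :
  \tr (X * W' ^+ i.+1 * W ^+ j) = \tr (X * W' ^+ i * W ^+ j.+1) + eps * G i j.
Proof.
rewrite exprSr exprS.
have -> : X * (W' ^+ i * W') = X * W' ^+ i * W + eps *: (X * W' ^+ i * X).
  by rewrite mulW' mulrDr -scaleMr !mulrA.
by rewrite mulrDl raddfD /= mulrA -scaleMl mxtraceZ.
Qed.

Lemma trace_mixed_ge i j : \tr (X * W ^+ (i + j)) <= \tr (X * W' ^+ i * W ^+ j).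
Proof.
elim: i j => [|i IH] j; first by rewrite add0n mulr1.
by rewrite stepXE addSnnS (le_trans (IH _))// lerDl mulr_ge0.
Qed.

Lemma trace_mulexp_le m : \tr (X * W ^+ m) <= \tr (X * W' ^+ m).
Proof. by have := trace_mixed_ge m 0; rewrite addn0 mulr1. Qed.

Lemma trace_exp_le m : \tr (W ^+ m) <= \tr (W' ^+ m).
Proof.
suff H i j : \tr (W ^+ (i + j)) <= \tr (W' ^+ i * W ^+ j).
  by have := H m 0%N; rewrite addn0 mulr1.
elim: i j => [|i IH] j; first by rewrite add0n mul1r.
rewrite addSnnS (le_trans (IH _))// [W' ^+ i.+1]exprSr [W ^+ j.+1]exprS.
have -> : W' ^+ i * W' = W' ^+ i * W + eps *: (W' ^+ i * X).
  exact: mulW'.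
rewrite mulrDl raddfD /= mulrA lerDl -scaleMl mxtraceZ mulr_ge0 //.
(* A product of three positive matrices may have negative trace. Transposing and cycling gives
   [tr (X W'^i W^j)], which is at least [tr (X W^(i+j))], a product of two. *)
rewrite -mxtrace_tr !trmxM trmx_exp // sX trmx_exp // mxtraceC.
apply: le_trans (trace_mixed_ge i j); apply: psd_mxtraceM_ge0 => //; exact: psd_exp.
Qed.

(** Expanding [0 <= tr (D^T W'^i D W^j)] with [D = W' X - X W] gives exactly the second difference
    of [G] along an antidiagonal. The choice of [D] replaces any commutation between [X], [W] and
    [W']. *)
Let Gconvex i j : 2 * G i.+1 j.+1 <= G i j.+2 + G i.+2 j.
Proof.
pose D := W' * X - X * W.
have := psd_mxtraceM_ge0 (psd_conj D (psd_exp i pW')) (psd_exp j pW).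
have cW' : W' * W' ^+ i = W' ^+ i * W' by rewrite -exprS exprSr.
have cW : W * W ^+ j = W ^+ j * W by rewrite -exprSr exprS.
have -> : (D^T *m W' ^+ i *m D) * W ^+ j =
    (X * W' ^+ i.+2 * X * W ^+ j - X * W' ^+ i.+1 * X * W ^+ j.+1)
  - (W * (X * W' ^+ i.+1 * X * W ^+ j) - W * (X * W' ^+ i * X * W ^+ j.+1)).
  rewrite /D !mulmxE linearB /= !trmxM sX sW sW' !exprS cW' -!mulrA cW.
  rewrite !(mulrBl, mulrBr) -!mulrA.
  rewrite (mulrA W' (W' ^+ i)) cW' -!mulrA.
  by rewrite !cW (mulrA W' (W' ^+ i)) cW' -!mulrA.
have e k l : \tr (W * (X * W' ^+ k * X * W ^+ l)) = G k l.+1.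
  by rewrite mxtraceC -mulrA -exprSr.
rewrite !mxtraceB !e -/(G i.+2 j) -/(G i.+1 j.+1); lra.
Qed.

(** The factors [W'] are exchanged one by one, at the cost [eps * G i (m - i)] each. By convexity
    [G i (m - i)] is largest at [i = 0] or [i = m]; there the two copies of [X] are adjacent up to
    cycling, and [X^2 <= c X] applies. *)
Lemma trace_mulexp_sub m :
  \tr (X * W' ^+ m.+1) - \tr (X * W ^+ m.+1) <=
  eps * m.+1%:R * c * \tr (X * W' ^+ m).
Proof.
have pX2 : psd (c *: X - X * X).
  (* Since [X] commutes with [c - X], this writes [X (c - X)] as a sum of two sandwiches, with no
     square root. *)
  have -> : c *: X - X * X =
      c^-1 *: (X * (c%:M - X) * X + (c%:M - X) * X * (c%:M - X)).
    have e1 : X * (c%:M - X) = c *: X - X * X.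
      by rewrite mulrBr -[in LHS]mulmxE mul_mx_scalar.
    have e2 : (c%:M - X) * X = c *: X - X * X.
      by rewrite mulrBl -[in LHS]mulmxE mul_scalar_mx.
    rewrite e1 e2 -mulrDr [X + _]addrC subrK -mulmxE mul_mx_scalar scalerA.
    by rewrite mulVf ?gt_eqF // scale1r.
  apply: psdZ; first by rewrite invr_ge0 ltW.
  apply: psdD; apply: psd_sandwich => //.
  by rewrite linearB /= tr_scalar_mx sX.
have X2 (Y : 'M[R]_n) : psd Y -> \tr (X * X * Y) <= c * \tr (X * Y).
  move=> /(psd_mxtraceM_ge0 pX2).
  by rewrite mulrBl mxtraceB subr_ge0 -scaleMl mxtraceZ.
have GB i : (i <= m)%N -> G i (m - i) <= c * \tr (X * W' ^+ m).
  move=> im; have := @convex_seq_le_max R (fun i => G i (m - i)) m i.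
  rewrite subnn subn0 => /(_ _ im) /le_trans; apply.
    move=> j jm; have -> : (m - j = (m - j.+2).+2)%N by lia.
    by have -> : (m - j.+1 = (m - j.+2).+1)%N by lia.
  rewrite ge_max; apply/andP; split.
    rewrite /G mulr1; apply: le_trans (X2 _ (psd_exp m pW)) _.
    by rewrite ler_wpM2l ?(ltW c0) // trace_mulexp_le.
  by rewrite /G mulr1 mxtraceC mulrA; exact: X2 (psd_exp m pW').
pose k i := \tr (X * W' ^+ i * W ^+ (m.+1 - i)).
have H i : (i <= m.+1)%N -> k i - k 0%N <= eps * i%:R * c * \tr (X * W' ^+ m).
  elim: i => [|i IH] im; first by rewrite subrr mulr0 !mul0r.
  rewrite /k subSS stepXE -subSn // -/(k i).
  have := IH (ltnW im); have := ler_wpM2l eps0 (GB i im).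
  rewrite -natr1; nra.
by have := H m.+1 (leqnn _); rewrite /k subnn mulr1 subn0 expr0 mulr1.
Qed.

End TraceStep.
End PSDpower.

(** * Bounded measurable functions and independence *)

Section BoundedMeasurable.
Context d (T : measurableType d) (R : realType).
Implicit Types f g : T -> R.

(** A class closed under sums and products and integrable against every finite measure. All
    integrability conditions below reduce to membership in it. *)
Definition bmf f := measurable_fun [set: T] f /\ exists C : R, forall x, `|f x| <= C.

Lemma bmf_ext f g : f =1 g -> bmf f -> bmf g.
Proof. by move=> /funext ->. Qed.

Lemma bmf_cst a : bmf (fun=> a).
Proof. by split=> //; exists `|a|. Qed.

Lemma bmfD f g : bmf f -> bmf g -> bmf (fun x => f x + g x).
Proof.
move=> [mf [C hC]] [mg [C' hC']]; split; first exact: measurable_funD.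
by exists (C + C') => x; rewrite (le_trans (ler_normD _ _))// lerD.
Qed.

Lemma bmfM f g : bmf f -> bmf g -> bmf (fun x => f x * g x).
Proof.
move=> [mf [C hC]] [mg [C' hC']]; split; first exact: measurable_funM.
by exists (C * C') => x; rewrite normrM ler_pM.
Qed.

Lemma bmfZ a f : bmf f -> bmf (fun x => a * f x).
Proof. by apply: bmfM; exact: bmf_cst. Qed.

Lemma bmfN f : bmf f -> bmf (fun x => - f x).
Proof. by move=> /(bmfZ (-1)); apply: bmf_ext => x; rewrite mulN1r. Qed.

Lemma bmfB f g : bmf f -> bmf g -> bmf (fun x => f x - g x).
Proof. by move=> bf /bmfN; exact: bmfD. Qed.

Lemma bmf_sum (I : Type) (s : seq I) (F : I -> T -> R) :
  (forall i, bmf (F i)) -> bmf (fun x => \sum_(i <- s) F i x).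
Proof.
move=> bF; elim: s => [|i s IH].
  by apply: bmf_ext (bmf_cst 0) => x; rewrite big_nil.
by apply: bmf_ext (bmfD (bF i) IH) => x; rewrite big_cons.
Qed.

Lemma bmf_prod (I : Type) (s : seq I) (F : I -> T -> R) :
  (forall i, bmf (F i)) -> bmf (fun x => \prod_(i <- s) F i x).
Proof.
move=> bF; elim: s => [|i s IH].
  by apply: bmf_ext (bmf_cst 1) => x; rewrite big_nil.
by apply: bmf_ext (bmfM (bF i) IH) => x; rewrite big_cons.
Qed.

Lemma bmfX n f : bmf f -> bmf (fun x => f x ^+ n).
Proof.
move=> bf; elim: n => [|n IH]; first exact: bmf_cst.
by apply: bmf_ext (bmfM bf IH) => x; rewrite exprS.
Qed.

Lemma bmf_indic (A : set T) : measurable A -> bmf (\1_A : T -> R).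
Proof.
move=> mA; split; first exact: measurable_indic.
by exists 1 => x; rewrite indicE normr_nat lern1 leq_b1.
Qed.

Section Integral.
Variable mu : {finite_measure set T -> \bar R}.

Lemma bmf_integrable f : bmf f -> mu.-integrable [set: T] (EFin \o f).
Proof.
move=> [mf [C hC]]; apply: measurable_bounded_integrable => //.
  by rewrite -ge0_fin_numE// fin_num_measure.
exists C; split; first exact: num_real.
by move=> y Cy x _ /=; apply: le_trans (hC x) _; exact: ltW.
Qed.

Lemma EFin_Rintegral f : bmf f ->
  (\int[mu]_x (f x)%:E)%E = (Rintegral mu [set: T] f)%:E.
Proof.
move=> bf; rewrite /Rintegral fineK//.
by apply: integrable_fin_num => //; exact: bmf_integrable.
Qed.

Lemma RintD f g : bmf f -> bmf g ->
  Rintegral mu [set: T] (fun x => f x + g x) = Rintegral mu [set: T] f + Rintegral mu [set: T] g.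
Proof. by move=> bf bg; apply: RintegralD => //; exact: bmf_integrable. Qed.

Lemma RintB f g : bmf f -> bmf g ->
  Rintegral mu [set: T] (fun x => f x - g x) = Rintegral mu [set: T] f - Rintegral mu [set: T] g.
Proof. by move=> bf bg; apply: RintegralB => //; exact: bmf_integrable. Qed.

Lemma RintZ a f : bmf f ->
  Rintegral mu [set: T] (fun x => a * f x) = a * Rintegral mu [set: T] f.
Proof. by move=> bf; apply: RintegralZl => //; exact: bmf_integrable. Qed.

Lemma Rint_sum (I : Type) (s : seq I) (F : I -> T -> R) :
  (forall i, bmf (F i)) ->
  Rintegral mu [set: T] (fun x => \sum_(i <- s) F i x) =
  \sum_(i <- s) Rintegral mu [set: T] (F i).
Proof.
move=> bF; elim: s => [|i s IH].
  rewrite big_nil; under eq_Rintegral do rewrite big_nil.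
  by rewrite Rintegral_cst// mul0r.
rewrite big_cons; under eq_Rintegral do rewrite big_cons.
by rewrite RintD ?IH//; exact: bmf_sum.
Qed.

Lemma Rint_le f g : bmf f -> bmf g -> (forall x, f x <= g x) ->
  Rintegral mu [set: T] f <= Rintegral mu [set: T] g.
Proof. by move=> bf bg fg; apply: le_Rintegral => //; exact: bmf_integrable. Qed.

(* No measurability of [f]: the integral is defined as a supremum over simple functions. *)
Lemma le_integral_bmf (f : T -> \bar R) g : bmf g ->
  (forall x, 0 <= f x)%E -> (forall x, f x <= (g x)%:E)%E ->
  (\int[mu]_x f x <= (Rintegral mu [set: T] g)%:E)%E.
Proof.
move=> bg f0 fg; rewrite -EFin_Rintegral//.
have g0 x : (0 <= (g x)%:E)%E by exact: le_trans (fg x).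
rewrite !ge0_integralTE//; apply: le_ereal_sup => _ [h hf <-].
by exists h => // x; exact: le_trans (fg x).
Qed.

End Integral.

Lemma Rint_cst (P : probability T R) a : Rintegral P [set: T] (fun=> a) = a.
Proof. by rewrite Rintegral_cst// [X in fine X]probability_setT mulr1. Qed.

(** The range of [f] is cut into slices of height [e], and [f] is rounded down to the bottom of its
    slice. Uniform approximation is what lets the error be integrated without a limit theorem. *)
Lemma bmf_step_approx f (e : R) : bmf f -> 0 < e ->
  exists (s : seq (R * set T)), (forall u, u \in s -> measurable u.2) /\
    forall x, `|f x - \sum_(u <- s) u.1 * \1_(u.2) x| <= e.
Proof.
move=> [mf [C hC]] e0.
pose A (k : nat) := f @^-1` `[k%:R * e - C, k.+1%:R * e - C[.
have mA k : measurable (A k).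
  by rewrite -[A k]setTI; apply: mf => //; exact: measurable_itv.
have [m hm] : exists m : nat, 2 * C < m%:R * e.
  exists (Num.truncn (2 * C / e)).+1.
  rewrite -ltr_pdivrMr//; exact: truncnS_gt.
exists [seq (k%:R * e - C, A k) | k <- iota 0 m]; split.
  by move=> u /mapP[k _ ->] /=; exact: mA.
move=> x; rewrite big_map/=.
have y0 : 0 <= (f x + C) / e.
  rewrite divr_ge0 ?(ltW e0)//; have := hC x; rewrite ler_norml; lra.
pose k0 := Num.truncn ((f x + C) / e).
have /andP[k1 k2] := truncn_itv y0.
have Ak k : \1_(A k) x = (k == k0)%:R :> R.
  rewrite indicE; congr (_%:R); congr (nat_of_bool _).
  apply/idP/eqP => [|->].
    rewrite inE /A/= in_itv/= => /andP[]; rewrite lerBlDr ltrBrDr -ler_pdivlMr// -ltr_pdivrMr// => h1 h2.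
    by apply/esym/truncn_def; rewrite h1 h2.
  rewrite inE /A/= in_itv/= lerBlDr ltrBrDr -ler_pdivlMr// -ltr_pdivrMr//.
  by rewrite k1 k2.
under eq_bigr do rewrite Ak.
have k0m : (k0 < m)%N.
  rewrite -(ltr_nat R); apply: le_lt_trans k1 _.
  rewrite ltr_pdivrMr//; apply: le_lt_trans hm.
  by have := hC x; rewrite ler_norml; lra.
rewrite (bigD1_seq k0) ?mem_iota ?iota_uniq//= eqxx mulr1 big1 ?addr0; last first.
  by move=> k /negPf ->; rewrite mulr0.
move: k1 k2; rewrite -/k0 ler_pdivlMr// ltr_pdivrMr// -natr1 mulrDl mul1r => h1 h2.
by rewrite ler_norml; lra.
Qed.

End BoundedMeasurable.

Lemma bmf_comp d1 d2 (T1 : measurableType d1) (T2 : measurableType d2) (R : realType)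
  (X : T1 -> T2) (g : T2 -> R) :
  measurable_fun [set: T1] X -> bmf g -> bmf (fun w => g (X w)).
Proof.
move=> mX [mg [C hC]]; split; first exact: measurableT_comp.
by exists C.
Qed.

Section Independence.
Context dO dT (Omega : measurableType dO) (T : measurableType dT) (R : realType).
Variables (P : probability Omega R) (p : probability T R) (N : nat).
Variable X : 'I_N -> Omega -> T.
Hypothesis mX : forall j, measurable_fun [set: Omega] (X j).
Hypothesis iidX : forall A : 'I_N -> set T, (forall j, measurable (A j)) ->
  P [set w | forall j, A j (X j w)] = (\prod_(j < N) fine (p (A j)))%:E.

Local Notation EP := (Rintegral P [set: Omega]).
Local Notation Ep := (Rintegral p [set: T]).

Let bmfX j (g : T -> R) : bmf g -> bmf (fun w => g (X j w)).
Proof. exact: bmf_comp. Qed.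

Lemma Rint_indic (A : set T) : measurable A -> Ep (\1_A : T -> R) = fine (p A).
Proof. by move=> mA; rewrite /Rintegral integral_indic// setIT. Qed.

(** Both sides are linear in [g] and continuous for the uniform norm, so the identity passes from
    indicators to step functions and then to bounded measurable functions. The total error is at
    most [e' (B + |c|)]; the extra 1 in the denominator of [e'] keeps it nonzero. *)
Lemma Rint_factor_extend j (Y : Omega -> R) (c : R) : bmf Y ->
  (forall A, measurable A -> EP (fun w => \1_A (X j w) * Y w) = fine (p A) * c) ->
  forall g : T -> R, bmf g -> EP (fun w => g (X j w) * Y w) = Ep g * c.
Proof.
move=> bY hA g bg; have [_ [B hB]] := bY.
have B0 : 0 <= B by apply: le_trans (hB point).
apply/eqP; rewrite -subr_eq0 -normr_le0; apply/ler_addgt0Pr => e e0; rewrite add0r.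
have D0 : 0 < B + `|c| + 1 by rewrite ltr_wpDl// addr_ge0.
have [s [ms hs]] := bmf_step_approx bg (divr_gt0 e0 D0).
set e' := e / _ in hs.
have e'0 : 0 < e' by exact: divr_gt0.
pose gs x : R := \sum_(u <- s) u.1 * \1_(u.2) x.
pose s' := [seq u <- s | `[< measurable u.2 >]].
have gsE x : gs x = \sum_(u <- s') u.1 * \1_(u.2) x.
  rewrite big_filter /gs big_seq_cond [RHS]big_seq_cond; apply: eq_bigl => u.
  by rewrite andbT; case: (boolP (u \in s)) => //= /ms /asboolP ->.
(* Only the members of [s] are known to carry measurable sets; [h] vanishes on every other pair, so
   that it is measurable for all indices, as [Rint_sum] requires. *)
pose h (u : R * set T) x : R := if `[< measurable u.2 >] then u.1 * \1_(u.2) x else 0.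
have bh u : bmf (h u).
  rewrite /h; case: asboolP => [mu|_]; last exact: bmf_cst.
  by apply: bmfZ; exact: bmf_indic.
have {}gsE x : gs x = \sum_(u <- s) h u x.
  by apply: eq_big_seq => u /ms mu; rewrite /h; case: asboolP.
have bgs : bmf gs by apply: (bmf_ext (fun x => esym (gsE x))); exact: bmf_sum.
have Egs : EP (fun w => gs (X j w) * Y w) = Ep gs * c.
  rewrite (_ : gs = fun x => \sum_(u <- s) h u x); last exact/funext.
  rewrite Rint_sum// mulr_suml.
  under eq_Rintegral do rewrite mulr_suml.
  rewrite (Rint_sum _ _ (F := fun u w => h u (X j w) * Y w)); last first.
    by move=> u; apply: bmfM => //; exact: bmfX.
  apply: eq_bigr => u _; rewrite /h; case: asboolP => [mu|_]; last first.
    by under eq_Rintegral do rewrite mul0r; rewrite !Rint_cst mul0r.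
  under eq_Rintegral do rewrite -mulrA.
  rewrite RintZ ?hA// ?RintZ ?Rint_indic// ?mulrA//; first exact: bmf_indic.
  by apply: bmfM => //; apply: bmfX; exact: bmf_indic.
have d1 : `|EP (fun w => g (X j w) * Y w) - EP (fun w => gs (X j w) * Y w)| <= e' * B.
  have b1 : bmf (fun w => g (X j w) * Y w) by apply: bmfM => //; exact: bmfX.
  have b2 : bmf (fun w => gs (X j w) * Y w) by apply: bmfM => //; exact: bmfX.
  rewrite -RintB// ler_norml -[X in X <= _ <= _](Rint_cst P) -[X in _ <= _ <= X](Rint_cst P).
  have key w : `|g (X j w) * Y w - gs (X j w) * Y w| <= e' * B.
    by rewrite -mulrBl normrM ler_pM.
  apply/andP; split; apply: Rint_le; try exact: bmf_cst; try exact: bmfB.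
    by move=> w; have := key w; rewrite ler_norml => /andP[].
  by move=> w; have := key w; rewrite ler_norml => /andP[].
have d2 : `|Ep g - Ep gs| <= e'.
  rewrite -RintB// ler_norml -[X in X <= _ <= _](Rint_cst p) -[X in _ <= _ <= X](Rint_cst p).
  apply/andP; split; apply: Rint_le; try exact: bmf_cst; try exact: bmfB.
    by move=> w; have := hs w; rewrite ler_norml => /andP[].
  by move=> w; have := hs w; rewrite ler_norml => /andP[].
rewrite (_ : _ - _ = (EP (fun w => g (X j w) * Y w) - EP (fun w => gs (X j w) * Y w))
   - (Ep g - Ep gs) * c); last by rewrite Egs; ring.
apply: le_trans (ler_normB _ _) _; rewrite normrM.
apply: (@le_trans _ _ (e' * B + e' * `|c|)); first by apply: lerD => //; exact: ler_wpM2r.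
have -> : e = e' * (B + `|c| + 1) by rewrite /e' divfK// gt_eqF.
by rewrite -mulrDr; apply: ler_wpM2l; [exact: ltW|rewrite lerDl].
Qed.

(** The hypothesis on the law treats products of indicators. The induction on [k] frees one factor
    at a time: those of index below [k] are arbitrary, the others are still indicators, and
    [Rint_factor_extend] frees the factor of index [k]. *)
Lemma Rint_prod (g : 'I_N -> T -> R) : (forall j, bmf (g j)) ->
  EP (fun w => \prod_j g j (X j w)) = \prod_j Ep (g j).
Proof.
move=> bg; suff H k : (k <= N)%N -> forall g : 'I_N -> T -> R, (forall j, bmf (g j)) ->
    (forall j : 'I_N, (k <= j)%N -> exists2 A, measurable A & g j = \1_A) ->
    EP (fun w => \prod_j g j (X j w)) = \prod_j Ep (g j).
  by apply: (H N) => // j; rewrite leqNgt ltn_ord.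
elim: k => [_|k IH kN] {bg}g bg gA.
  have /choice[A hA] : forall j, exists A, measurable A /\ g j = \1_A.
    by move=> j; have [A mA gAE] := gA j (leq0n _); exists A.
  have mA j : measurable (A j) by have [] := hA j.
  under eq_bigr do rewrite (hA _).2 Rint_indic//.
  set B := [set w | forall j, A j (X j w)].
  have BE : B = \big[setI/setT]_(j < N) (X j @^-1` A j).
    apply/seteqP; split => w /=.
      by move=> h; rewrite -bigcap_seq => j _; exact: h.
    by rewrite -bigcap_seq => h j; apply: h; rewrite /= mem_index_enum.
  have mB : measurable B.
    rewrite BE; apply: bigsetI_measurable => j _.
    by rewrite -[X in measurable X]setTI; exact: mX.
  rewrite (_ : (fun w => _) = \1_B); last first.
    apply/funext => w; under eq_bigr do rewrite (hA _).2 indicE.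
    rewrite indicE; case: (boolP (w \in B)); rewrite (in_setE, notin_setE) => h.
      by rewrite big1// => j _; rewrite mem_set//; exact: h.
    have [j hj] : exists j, ~ A j (X j w) by apply/existsNP.
    by rewrite (bigD1 j)//= memNset// mul0r.
  by rewrite /Rintegral integral_indic// setIT; have /(congr1 fine) h := iidX mA; exact: h.
pose j : 'I_N := Ordinal kN.
rewrite (bigD1 j)//=; under eq_Rintegral do rewrite (bigD1 j)//=.
apply: (Rint_factor_extend (j := j)) => //.
  apply: bmf_ext (bmf_prod [seq i <- index_enum 'I_N | i != j] (fun i => bmfX i (bg i))) => w.
  by rewrite big_filter.
move=> A mA.
pose g' i := if i == j then \1_A else g i.
have := IH (ltnW kN) g'; rewrite (bigD1 j)//=.
under eq_Rintegral do rewrite (bigD1 j)//=.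
have -> : g' j = \1_A by rewrite /g' eqxx.
rewrite Rint_indic// => H.
transitivity (EP (fun w => \1_A (X j w) * \prod_(i < N | i != j) g' i (X i w))).
  by apply: eq_Rintegral => w _; congr (_ * _); apply: eq_bigr => i /negPf; rewrite /g' => ->.
rewrite H.
- by congr (_ * _); apply: eq_bigr => i /negPf; rewrite /g' => ->.
- by move=> i; rewrite /g'; case: eqP => // _; exact: bmf_indic.
- move=> i ki; rewrite /g'; case: eqP => [_|/eqP ij]; first by exists A.
  by apply: gA; rewrite ltn_neqAle ki andbT eq_sym.
Qed.

(* The algebra of bounded functions of the sample points other than the [j]-th. *)
Definition span_off j (Z : Omega -> R) := exists (I : finType) (a : I -> R) (g : I -> 'I_N -> T -> R),
  [/\ forall i k, bmf (g i k), forall i, g i j = (fun=> 1) &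
      forall w, Z w = \sum_i a i * \prod_k g i k (X k w)].

Lemma span_off_cst j a : span_off j (fun=> a).
Proof.
exists unit, (fun=> a), (fun _ _ _ => 1); split => //; first by move=> *; exact: bmf_cst.
by move=> w; rewrite (big_pred1 tt) => [|[]//]; rewrite big1 ?mulr1.
Qed.

Lemma span_off_gen j k (f : T -> R) : k != j -> bmf f -> span_off j (fun w => f (X k w)).
Proof.
move=> kj bf; exists unit, (fun=> 1), (fun _ i => if i == k then f else fun=> 1); split.
- by move=> _ i; case: eqP => // _; exact: bmf_cst.
- by move=> _; rewrite eq_sym (negPf kj).
- move=> w; rewrite (big_pred1 tt) => [|[]//]; rewrite mul1r (bigD1 k)//= eqxx.
  by rewrite big1 ?mulr1// => i /negPf ->.
Qed.

Lemma span_offD j Y Z : span_off j Y -> span_off j Z -> span_off j (fun w => Y w + Z w).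
Proof.
move=> [I [a [g [bg gj YE]]]] [I' [a' [g' [bg' gj' ZE]]]].
exists (I + I')%type, (fun i => match i with inl i => a i | inr i => a' i end),
  (fun i => match i with inl i => g i | inr i => g' i end); split.
- by case.
- by case.
- by move=> w; rewrite YE ZE big_sumType.
Qed.

Lemma span_offM j Y Z : span_off j Y -> span_off j Z -> span_off j (fun w => Y w * Z w).
Proof.
move=> [I [a [g [bg gj YE]]]] [I' [a' [g' [bg' gj' ZE]]]].
exists (I * I')%type, (fun i => a i.1 * a' i.2),
  (fun i k x => g i.1 k x * g' i.2 k x); split.
- by move=> i k; exact: bmfM.
- by move=> i; rewrite gj gj' mul1r.
- move=> w; rewrite YE ZE mulr_suml -(pair_bigA _ (fun i i' => (a i * a' i') *
    \prod_k (g i k (X k w) * g' i' k (X k w)))) /=.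
  apply: eq_bigr => i _; rewrite mulr_sumr; apply: eq_bigr => i' _.
  by rewrite big_split/= mulrACA.
Qed.

Lemma span_off_sum j (I : Type) (s : seq I) (Q : pred I) (F : I -> Omega -> R) :
  (forall i, Q i -> span_off j (F i)) -> span_off j (fun w => \sum_(i <- s | Q i) F i w).
Proof.
move=> hF; elim: s => [|i s IH].
  by under eq_fun do rewrite big_nil; exact: span_off_cst.
under eq_fun do rewrite big_cons; case: (boolP (Q i)) => // Qi.
by apply: span_offD => //; exact: hF.
Qed.

(** Each product in the expansion of [Z] has the constant 1 in slot [j]. Placing [f] in that slot
    gives again a full product, to which [Rint_prod] applies. *)
Lemma Rint_span_off j (f : T -> R) Z : bmf f -> span_off j Z ->
  EP (fun w => f (X j w) * Z w) = Ep f * EP Z.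
Proof.
move=> bf [I [a [g [bg gj ZE]]]]; rewrite (funext ZE).
have bG i : bmf (fun w => \prod_k g i k (X k w)).
  by apply: bmf_prod => k; exact: bmfX.
rewrite Rint_sum; last by move=> i; exact: bmfZ.
under eq_Rintegral do rewrite mulr_sumr.
rewrite (Rint_sum _ _ (F := fun i w => f (X j w) * (a i * \prod_k g i k (X k w)))); last first.
  by move=> i; apply: bmfM; [exact: bmfX|exact: bmfZ].
rewrite mulr_sumr; apply: eq_bigr => i _; rewrite RintZ// Rint_prod//.
under eq_Rintegral do rewrite mulrCA.
rewrite RintZ; last by apply: bmfM => //; exact: bmfX.
rewrite mulrCA; congr (_ * _).
pose g' k := if k == j then f else g i k.
transitivity (EP (fun w => \prod_k g' k (X k w))).
  apply: eq_Rintegral => w _; rewrite (bigD1 j)//= [RHS](bigD1 j)//= gj mul1r /g' eqxx.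
  by congr (_ * _); apply: eq_bigr => k /negPf ->.
rewrite Rint_prod; last by move=> k; rewrite /g'; case: ifP.
rewrite (bigD1 j)//= [in RHS](bigD1 j)//= gj Rint_cst mul1r /g' eqxx.
by congr (_ * _); apply: eq_bigr => k /negPf ->.
Qed.

End Independence.

(** * Lower-tail matrix Chernoff bound *)

Lemma bform_sum (R : realFieldType) n (I : Type) (s : seq I) (Q : pred I) (F : I -> 'M[R]_n) u v :
  bform (\sum_(i <- s | Q i) F i) u v = \sum_(i <- s | Q i) bform (F i) u v.
Proof.
apply: (big_morph (fun A => bform A u v)) => [A B|]; first exact: bformMD.
by rewrite /bform mulmx0 mul0mx mxE.
Qed.

Lemma bform1_ge0 (R : realFieldType) n (v : 'rV[R]_n) : 0 <= bform 1%:M v v.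
Proof. by rewrite bform1 sumr_ge0// => i _; rewrite -expr2 sqr_ge0. Qed.

Section MatrixChernoff.
Context dO dT (Omega : measurableType dO) (T : measurableType dT) (R : realType).
Variables (P : probability Omega R) (p : probability T R) (N n : nat).
Variable X : 'I_N -> Omega -> T.
Hypothesis mX : forall j, measurable_fun [set: Omega] (X j).
Hypothesis iidX : forall A : 'I_N -> set T, (forall j, measurable (A j)) ->
  P [set w | forall j, A j (X j w)] = (\prod_(j < N) fine (p (A j)))%:E.
Variables (A : T -> 'M[R]_n) (c : R).
Hypothesis bA : forall i k, bmf (fun x => A x i k).
Hypothesis pA : forall x, psd (A x).
Hypothesis pcA : forall x, psd (c%:M - A x).
Hypothesis c1 : 1 <= c.
Hypothesis EA : forall i k, Rintegral p [set: T] (fun x => A x i k) = (i == k)%:R.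

Local Notation EP := (Rintegral P [set: Omega]).

Let c0 : 0 < c. Proof. exact: lt_le_trans c1. Qed.

Lemma span_off_mulmx j (B C : Omega -> 'M[R]_n) :
  (forall i k, span_off X j (fun w => B w i k)) ->
  (forall i k, span_off X j (fun w => C w i k)) ->
  forall i k, span_off X j (fun w => (B w *m C w) i k).
Proof.
move=> hB hC i k; under eq_fun do rewrite mxE.
by apply: span_off_sum => l _; exact: span_offM.
Qed.

Lemma span_off_mxexp j (B : Omega -> 'M[R]_n) m :
  (forall i k, span_off X j (fun w => B w i k)) ->
  forall i k, span_off X j (fun w => (B w ^+ m) i k).
Proof.
move=> hB; elim: m => [|m IH] i k.
  by under eq_fun do rewrite expr0 mxE; exact: span_off_cst.
by under eq_fun do rewrite exprS; exact: span_off_mulmx.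
Qed.

Lemma bmf_mulmx (B C : Omega -> 'M[R]_n) :
  (forall i k, bmf (fun w => B w i k)) -> (forall i k, bmf (fun w => C w i k)) ->
  forall i k, bmf (fun w => (B w *m C w) i k).
Proof.
move=> hB hC i k; under eq_fun do rewrite mxE.
by apply: bmf_sum => l; exact: bmfM.
Qed.

Lemma bmf_mxexp (B : Omega -> 'M[R]_n) m :
  (forall i k, bmf (fun w => B w i k)) -> forall i k, bmf (fun w => (B w ^+ m) i k).
Proof.
move=> hB; elim: m => [|m IH] i k.
  by under eq_fun do rewrite expr0 mxE; exact: bmf_cst.
by under eq_fun do rewrite exprS; exact: bmf_mulmx.
Qed.

Lemma bmf_trace (B : Omega -> 'M[R]_n) :
  (forall i k, bmf (fun w => B w i k)) -> bmf (fun w => \tr (B w)).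
Proof. by move=> hB; apply: bmf_sum. Qed.

Section Fixed_eps.
Variable eps : R.
Hypotheses (eps0 : 0 <= eps) (epsN : eps * N%:R * c < 1).
(** A lower bound for the spectrum of [W], as each of the [N] summands is at most [c]. *)
Let w0 := 1 - eps * N%:R * c.
Let w0_gt0 : 0 < w0. Proof. by rewrite subr_gt0. Qed.

Let S w := \sum_(j < N) A (X j w).
Let W w := 1%:M - eps *: S w.
Let W' j w := W w + eps *: A (X j w).

Let bform_A_le x v : bform (A x) v v <= c * bform 1%:M v v.
Proof. by have := (pcA x).2 v; rewrite bformMD bformMN bform_scalar subr_ge0. Qed.

Let pS w : psd (S w). Proof. exact: psd_sum. Qed.

Let pWw0 w : psd (W w - w0%:M).
Proof.
split; first by rewrite !linearB /= linearZ /= !tr_scalar_mx (pS w).1.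
move=> v; rewrite !bformMD !bformMN bformMZ [bform w0%:M _ _]bform_scalar bform_sum.
have H : \sum_(j < N) bform (A (X j w)) v v <= N%:R * c * bform 1%:M v v.
  apply: le_trans (_ : \sum_(j < N) c * bform 1%:M v v <= _).
    by apply: ler_sum => j _.
  by rewrite sumr_const card_ord -mulrA mulr_natl.
have := ler_wpM2l eps0 H; rewrite /w0; lra.
Qed.

Let pW w : psd (W w).
Proof.
rewrite -[W w](subrK (w0%:M)); apply: psdD => //.
by apply: psd_scalar; exact: ltW.
Qed.

Let pW' j w : psd (W' j w). Proof. by apply: psdD => //; exact: psdZ. Qed.

Let pW'w0 j w : psd (W' j w - w0%:M).
Proof. by rewrite /W' addrAC; apply: psdD => //; exact: psdZ. Qed.

Let bAX j i k : bmf (fun w => A (X j w) i k).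
Proof. exact: (bmf_comp (g := fun x => A x i k)). Qed.

Let bW i k : bmf (fun w => W w i k).
Proof.
have -> : (fun w => W w i k) =
    fun w => (1%:M : 'M[R]_n) i k - eps * \sum_(j < N) A (X j w) i k.
  by apply/funext => w; rewrite !mxE summxE.
by apply: bmfB; [exact: bmf_cst|apply: bmfZ; exact: bmf_sum].
Qed.

Let bW' j i k : bmf (fun w => W' j w i k).
Proof.
have -> : (fun w => W' j w i k) = fun w => W w i k + eps * A (X j w) i k.
  by apply/funext => w; rewrite [LHS]mxE [X in _ + X]mxE.
by apply: bmfD => //; exact: bmfZ.
Qed.

Let span_W' j i k : span_off X j (fun w => W' j w i k).
Proof.
rewrite (_ : (fun w => _) = fun w => (1%:M : 'M[R]_n) i k +
   \sum_(l < N | l != j) (- eps) * A (X l w) i k); last first.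
  apply/funext => w; rewrite !mxE summxE (bigD1 j)//= -mulr_sumr; ring.
apply: span_offD; first exact: span_off_cst.
apply: span_off_sum => l lj; apply: span_offM; first exact: span_off_cst.
exact: (@span_off_gen _ _ _ _ _ _ X j l (fun x => A x i k)).
Qed.

(** Entry by entry, [A (X j)] is independent of [W' j]; its mean is the identity, so only the
    diagonal terms survive. *)
Let expect_trace_off j m : EP (fun w => \tr (A (X j w) * W' j w ^+ m)) =
  EP (fun w => \tr (W' j w ^+ m)).
Proof.
have bE i k : bmf (fun w => (W' j w ^+ m) i k) by exact: bmf_mxexp.
rewrite /mxtrace; under eq_Rintegral do under eq_bigr do rewrite mxE.
rewrite (Rint_sum _ _ (F := fun i w => \sum_k A (X j w) i k * (W' j w ^+ m) k i)); last first.
  by move=> i; apply: bmf_sum => k; apply: bmfM.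
rewrite Rint_sum//; apply: eq_bigr => i _.
rewrite (Rint_sum _ _ (F := fun k w => A (X j w) i k * (W' j w ^+ m) k i)); last first.
  by move=> k; apply: bmfM.
transitivity (\sum_k (i == k)%:R * EP (fun w => (W' j w ^+ m) k i)).
  apply: eq_bigr => k _; rewrite -EA.
  apply: (Rint_span_off mX iidX (f := fun x => A x i k)) => //.
  exact: span_off_mxexp.
rewrite (bigD1 i)//= eqxx mul1r big1 ?addr0// => k /negPf.
by rewrite eq_sym => ->; rewrite mul0r.
Qed.

Let a m := EP (fun w => \tr (W w ^+ m)).

Let ba m : bmf (fun w => \tr (W w ^+ m)).
Proof. by apply: bmf_trace; exact: bmf_mxexp. Qed.

Let bb j m : bmf (fun w => \tr (W' j w ^+ m)).
Proof. by apply: bmf_trace; exact: bmf_mxexp. Qed.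

Let bAW j m : bmf (fun w => \tr (A (X j w) * W w ^+ m)).
Proof. by apply: bmf_trace; apply: bmf_mulmx => //; exact: bmf_mxexp. Qed.

Let bAW' j m : bmf (fun w => \tr (A (X j w) * W' j w ^+ m)).
Proof. by apply: bmf_trace; apply: bmf_mulmx => //; exact: bmf_mxexp. Qed.

(** After [trace_mulexp_sub] and independence, the loss is [eps m c] times the expected trace of
    [W'^(m-1)]. Since [W' >= w0], that trace is at most [tr (W'^m) / w0], so the loss becomes a
    relative one. The condition on [m] makes the remaining factor nonnegative, which allows [W'] to
    be replaced by the smaller [W]. *)
Let trace_AW_ge j m : eps * m%:R * c <= w0 ->
  (1 - eps * m%:R * c / w0) * a m <= EP (fun w => \tr (A (X j w) * W w ^+ m)).
Proof.
case: m => [_|m hm].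
  have <- : EP (fun w => \tr (A (X j w) * W' j w ^+ 0)) =
      EP (fun w => \tr (A (X j w) * W w ^+ 0)) by [].
  by rewrite expect_trace_off mulr0 !mul0r subr0 mul1r.
have K0 : 0 <= eps * m.+1%:R * c by rewrite !mulr_ge0// ltW.
apply: (@le_trans _ _ (EP (fun w => \tr (A (X j w) * W' j w ^+ m.+1) -
    eps * m.+1%:R * c * \tr (A (X j w) * W' j w ^+ m)))); last first.
  apply: Rint_le => //; first by apply: bmfB => //; exact: bmfZ.
  move=> w; rewrite lerBlDl -lerBlDr.
  exact: (trace_mulexp_sub eps0 c0 (pA _) (pcA _) (pW w)).
rewrite RintB// ?RintZ//; last exact: bmfZ.
rewrite !expect_trace_off.
have h1 : a m.+1 <= EP (fun w => \tr (W' j w ^+ m.+1)).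
  by apply: Rint_le => // w; apply: trace_exp_le.
have h2 : w0 * EP (fun w => \tr (W' j w ^+ m)) <= EP (fun w => \tr (W' j w ^+ m.+1)).
  rewrite -RintZ//; apply: Rint_le => //; first exact: bmfZ.
  by move=> w; exact: trace_exp_lower.
set K := eps * _ * c in K0 hm *.
have k1 : K / w0 <= 1 by rewrite ler_pdivrMr// mul1r.
have h3 : EP (fun w => \tr (W' j w ^+ m)) <= EP (fun w => \tr (W' j w ^+ m.+1)) / w0.
  by rewrite ler_pdivlMr// mulrC.
apply: (@le_trans _ _ ((1 - K / w0) * EP (fun w => \tr (W' j w ^+ m.+1)))).
  by apply: ler_wpM2l => //; rewrite subr_ge0.
have := ler_wpM2l K0 h3.
set Y := EP (fun w => \tr (W' j w ^+ m.+1)); set Y' := EP _ => h4.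
rewrite mulrBl mul1r lerD2l lerN2 (_ : K / w0 * Y = K * (Y / w0))//; ring.
Qed.

Let a_ge0 m : 0 <= a m.
Proof. by apply: Rintegral_ge0 => w _; apply: psd_trace_ge0; exact: psd_exp. Qed.

Let a_rec m : eps * m%:R * c <= w0 ->
  a m.+1 <= a m * expR (- (eps * N%:R * (1 - eps * m%:R * c / w0))).
Proof.
move=> hm; have -> : a m.+1 = a m - eps * \sum_(j < N) EP (fun w => \tr (A (X j w) * W w ^+ m)).
  rewrite -Rint_sum// -RintZ; last exact: bmf_sum.
  rewrite -RintB//; last by apply: bmfZ; exact: bmf_sum.
  apply: eq_Rintegral => w _; rewrite exprS {1}/W mulrBl mul1r mxtraceB -scaleMl mxtraceZ.
  by rewrite /S mulr_suml raddf_sum.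
set q := 1 - _.
apply: (@le_trans _ _ (a m * (1 - eps * N%:R * q))).
  have H : \sum_(j < N) q * a m <= \sum_(j < N) EP (fun w => \tr (A (X j w) * W w ^+ m)).
    by apply: ler_sum => j _; exact: trace_AW_ge.
  rewrite sumr_const card_ord -[_ *+ N]mulr_natl in H.
  have := ler_wpM2l eps0 H; lra.
by apply: ler_wpM2l => //; have := expR_ge1Dx (- (eps * N%:R * q)).
Qed.

(** The exponents of [a_rec] add up, with [0 + 1 + ... + (m - 1)] bounded by [m^2 / 2]. *)
Lemma expect_trace_exp_le m : eps * m%:R * c <= w0 ->
  EP (fun w => \tr (W w ^+ m)) <=
  n%:R * expR (- (eps * N%:R * (m%:R - eps * c * m%:R ^+ 2 / (2 * w0)))).
Proof.
rewrite -/(a m); elim: m => [_|m IH hm].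
  rewrite /a; under eq_Rintegral do rewrite expr0 mxtrace1.
  by rewrite Rint_cst expr0n /= mulr0 mul0r subr0 mulr0 oppr0 expR0 mulr1.
have hm' : eps * m%:R * c <= w0.
  apply: le_trans hm; rewrite ler_wpM2r ?(ltW c0)// ler_wpM2l// ler_nat//.
apply: le_trans (a_rec hm') _.
apply: (le_trans (ler_wpM2r (expR_ge0 _) (IH hm'))).
rewrite -[leLHS]mulrA -expRD ler_wpM2l// ler_expR -opprD lerN2 -mulrDr.
apply: ler_wpM2l; first by rewrite mulr_ge0.
have : 0 <= eps * c / (2 * w0).
  by rewrite divr_ge0// ?mulr_ge0// ltW.
rewrite -(natr1 m); set x := m%:R; set z := _ / (2 * w0) => z0.
have -> : eps * c * (x + 1) ^+ 2 / (2 * w0) = z * (x + 1) ^+ 2 by rewrite /z mulrAC.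
have -> : eps * c * x ^+ 2 / (2 * w0) = z * x ^+ 2 by rewrite /z mulrAC.
have -> : eps * x * c / w0 = z * (2 * x) by rewrite /z; field; rewrite gt_eqF.
lra.
Qed.

Lemma trace_exp_ge_of_small w m (t : R) (v : 'rV[R]_n) : 0 <= t -> eps * t <= 1 ->
  bform (S w) v v < t * bform 1%:M v v -> (1 - eps * t) ^+ m <= \tr (W w ^+ m).
Proof.
move=> t0 et hv.
have v0 : 0 < bform 1%:M v v.
  rewrite lt_neqAle bform1_ge0 andbT eq_sym; apply/eqP => v0.
  by move: hv; rewrite v0 mulr0 ltNge (pS w).2.
apply: (trace_exp_ge m (pW w) _ v0); first by rewrite subr_ge0.
rewrite /W bformMD bformMN bformMZ mulrBl mul1r lerD2l lerN2 -mulrA.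
by rewrite ler_wpM2l// ltW.
Qed.

Lemma bmf_trace_W m : bmf (fun w => \tr (W w ^+ m)).
Proof. exact: ba. Qed.

Lemma trace_W_ge0 w m : 0 <= \tr (W w ^+ m).
Proof. by apply: psd_trace_ge0; exact: psd_exp. Qed.

End Fixed_eps.

(* [Z] is a measurable majorant of the indicator of the event that the smallest
   eigenvalue is small, which spares us the measurability of that event. *)
Lemma matrix_chernoff (delta : R) : (0 < N)%N -> 0 < delta -> delta <= 1 / 2 ->
  exists Z : Omega -> R, [/\ bmf Z, forall w, 0 <= Z w,
    EP Z <= 2 * n%:R * expR (- (N%:R * delta ^+ 2 / (2 * c))) &
    forall w v, bform (\sum_(j < N) A (X j w)) v v < N%:R * (1 - delta) * bform 1%:M v v ->
      1 <= Z w].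
Proof.
move=> N0 d0 d1.
have N1 : 1 <= N%:R :> R by rewrite ler1n.
(* [W^m] plays the role of [exp (- theta S)] with [theta = eps * m = delta / c]. Taking [m = 4 N^2]
   gives [h = eps N c = delta / (4 N)], so small that all discretisation errors together add less
   than [1/2] to the exponent; the factor [2 >= exp (1/2)] in the bound absorbs them. *)
pose m := (4 * N ^ 2)%N.
have mE : m%:R = 4 * N%:R ^+ 2 :> R by rewrite natrM natrX.
have m0 : 0 < m%:R :> R by rewrite mE; nra.
pose eps := delta / (m%:R * c).
have mc0 : 0 < m%:R * c by rewrite mulr_gt0.
have eps0 : 0 <= eps by rewrite divr_ge0 ?ltW.
have emc : eps * m%:R * c = delta by rewrite -mulrA divfK// gt_eqF.
pose h := eps * N%:R * c.
have hE : 4 * N%:R * h = delta.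
  by rewrite -emc mE /h; ring.
have h0 : 0 <= h by apply: mulr_ge0; [exact: mulr_ge0|exact: ltW].
have h8 : h <= 1 / 8 by nra.
have epsN : eps * N%:R * c < 1 by rewrite -/h; lra.
have hm : eps * m%:R * c <= 1 - eps * N%:R * c by rewrite emc -/h; lra.
pose t := N%:R * (1 - delta).
have t0 : 0 <= t by rewrite mulr_ge0//; lra.
have eth : eps * t <= h.
  rewrite /t /h mulrA; apply: ler_wpM2l; [exact: mulr_ge0|by rewrite (le_trans _ c1)// gerBl ltW].
(* The value that [tr (W^m)] reaches on the bad event; dividing by it prepares Markov's
   inequality. *)
pose q := (1 - eps * t) ^+ m.
have et1 : 0 < 1 - eps * t by lra.
have q0 : 0 < q by rewrite exprn_gt0.
exists (fun w => q^-1 * \tr ((1%:M - eps *: \sum_(j < N) A (X j w)) ^+ m)); split.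
- by apply: bmfZ; exact: bmf_trace_W.
- by move=> w; rewrite mulr_ge0 ?invr_ge0 ?(ltW q0)// trace_W_ge0.
- rewrite RintZ; last exact: bmf_trace_W.
  apply: (le_trans (ler_wpM2l _ (expect_trace_exp_le eps0 epsN hm))).
    by rewrite invr_ge0 ltW.
  (* From [1 / (1 - x) = 1 + x / (1 - x) <= exp (x / (1 - x))] with [x = eps * t]. *)
  have qe : q^-1 <= expR (eps * t / (1 - eps * t) * m%:R).
    rewrite expRM_natr -exprVn; apply: lerXn2r; rewrite ?nnegrE ?expR_ge0 ?invr_ge0 ?(ltW et1)//.
    apply: le_trans (expR_ge1Dx _); rewrite le_eqVlt; apply/orP; left; apply/eqP.
    by field; rewrite gt_eqF.
  apply: (le_trans (ler_wpM2r _ qe)); first by rewrite mulr_ge0// expR_ge0.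
  rewrite mulrCA -expRD [2 * n%:R]mulrC -[leRHS]mulrA ler_wpM2l//.
  have e2 : expR (1 / 2) <= 2 :> R.
    have := expR_ge1Dx (- (1 / 2) : R); rewrite expRN => e.
    have E0 := expR_gt0 (1 / 2 : R).
    have := ler_wpM2l (ltW E0) e; rewrite divff ?gt_eqF//; lra.
  apply: (@le_trans _ _ (expR (1 / 2) * expR (- (N%:R * delta ^+ 2 / (2 * c))))); last first.
    by rewrite ler_wpM2r ?expR_ge0.
  rewrite -expRD ler_expR.
  pose D := delta / c; have D0 : 0 <= D by rewrite divr_ge0 ?ltW.
  have Dd : D <= delta by rewrite ler_pdivrMr// ler_peMr// ltW.
  have emD : eps * m%:R = D by rewrite /D -emc mulfK// gt_eqF.
  rewrite -/h; set w0 := 1 - h.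
  have w01 : w0^-1 <= 1 + 2 * h.
    by rewrite -[w0^-1]mul1r ler_pdivrMr /w0; nra.
  have et2 : (1 - eps * t)^-1 <= 1 + 2 * h.
    by apply: le_trans w01; rewrite lef_pV2 ?posrE//; rewrite /w0; lra.
  have -> : eps * N%:R * (m%:R - eps * c * m%:R ^+ 2 / (2 * w0)) =
      N%:R * D * (1 - delta / 2 * w0^-1).
    by rewrite -emD -emc invfM; ring.
  have -> : eps * t / (1 - eps * t) * m%:R = N%:R * D * ((1 - delta) * (1 - eps * t)^-1).
    by rewrite -emD /t; ring.
  have -> : N%:R * delta ^+ 2 / (2 * c) = N%:R * D * (delta / 2).
    by rewrite /D invfM; ring.
  have ND0 : 0 <= N%:R * D by rewrite mulr_ge0.
  have b1 : (1 - delta) * (1 - eps * t)^-1 <= (1 - delta) * (1 + 2 * h).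
    by apply: ler_wpM2l => //; lra.
  have b2 : delta / 2 * w0^-1 <= delta / 2 * (1 + 2 * h).
    by apply: ler_wpM2l => //; lra.
  have b3 : N%:R * D * ((1 - delta) * (1 - eps * t)^-1 + delta / 2 * w0^-1) <=
      N%:R * D * ((1 - delta) * (1 + 2 * h) + delta / 2 * (1 + 2 * h)).
    by apply: ler_wpM2l => //; exact: lerD.
  have b4 : N%:R * D * h <= 1 / 16.
    have -> : N%:R * D * h = D * (N%:R * h) by ring.
    have -> : N%:R * h = delta / 4 by rewrite -hE; field.
    by nra.
  have b5 : 0 <= N%:R * D * h * delta.
    by apply: mulr_ge0; [exact: mulr_ge0|exact: ltW].
  nra.
- move=> w v hv; rewrite mulrC ler_pdivlMr// mul1r.
  by apply: (trace_exp_ge_of_small eps0 epsN m t0 _ hv); apply: le_trans eth (ltW epsN).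
Qed.

End MatrixChernoff.

(** * Measurability of cylinder functions *)

Lemma rat_approx (R : realType) (x e : R) : 0 < e -> exists q : rat, `|ratr q - x| < e.
Proof.
move=> e0; have : x - e < x + e by lra.
move=> /rat_in_itvoo[q]; rewrite in_itv/= => hq; exists q.
by rewrite ltr_norml; lra.
Qed.

(** Only the coordinates of [L] are known to be measurable. An open set is the union of the boxes
    with rational centre and half-width [1 / (k + 1)] that it contains. There are countably many of
    them, and the preimage of a box is a finite intersection of coordinate conditions. *)
Lemma continuous_comp_row_measurable dT (T : measurableType dT) (R : realType) m
    (psi : 'rV[R]_m -> R) (L : T -> 'rV[R]_m) :
  continuous psi -> (forall k, measurable_fun [set: T] (fun x => L x 0 k)) ->
  measurable_fun [set: T] (fun x => psi (L x)).
Proof.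
move=> cpsi mL.
have mbox (q : 'rV[R]_m) (e : R) : measurable [set x | forall k, `|q 0 k - L x 0 k| < e].
  have -> : [set x | forall k, `|q 0 k - L x 0 k| < e] =
      \big[setI/setT]_(k < m) ((fun x => L x 0 k) @^-1` `]q 0 k - e, q 0 k + e[).
    apply/seteqP; split => x /=.
      move=> h; rewrite -bigcap_seq => k _ /=; rewrite in_itv/=.
      by have := h k; rewrite ltr_norml; lra.
    rewrite -bigcap_seq => h k; have /= := h k (mem_index_enum k).
    by rewrite in_itv/= ltr_norml; lra.
  apply: bigsetI_measurable => k _; rewrite -[X in measurable X]setTI.
  by apply: mL => //; exact: measurable_itv.
have mopen (O : set 'rV[R]_m) : open O -> measurable (L @^-1` O).
  move=> oO.
  pose box (u : 'rV[rat]_m * nat) := [set x | forall k, `|ratr (u.1 0 k) - L x 0 k| < u.2.+1%:R^-1 :> R].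
  pose good (u : 'rV[rat]_m * nat) := forall y : 'rV[R]_m,
    (forall k, `|ratr (u.1 0 k) - y 0 k| < u.2.+1%:R^-1 :> R) -> O y.
  have -> : L @^-1` O = \bigcup_u (if `[< good u >] then box u else set0).
    apply/seteqP; split => x /=; last first.
      by move=> [u _]; case: asboolP => // gu; exact: gu.
    move=> Ox; have /nbhs_ballP[e /= e0 he] := open_nbhs_nbhs (conj oO Ox).
    pose N := Num.truncn (2 / e).
    (* The box has half-width [1 / (N + 1)] and contains [L x], so by way of its centre each of its
       points is within [2 / (N + 1)] of [L x]. *)
    have eN : 2 * N.+1%:R^-1 < e.
      by rewrite ltr_pdivrMr// -ltr_pdivrMl// mulrC; exact: truncnS_gt.
    have N0 : 0 < N.+1%:R^-1 :> R by rewrite invr_gt0.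
    have /choice[q hq] : forall k, exists q : rat, `|ratr q - L x 0 k| < N.+1%:R^-1 :> R.
      by move=> k; exact: rat_approx.
    exists (\row_k q k, N) => //; rewrite asboolT; last first.
      move=> y /= hy; apply: he; split => // i k; rewrite ord1 /ball/=.
      have := hy k; have := hq k; rewrite mxE => h1 h2.
      rewrite (le_lt_trans (ler_distD (ratr (q k)) _ _))//.
      by rewrite distrC (lt_trans _ eN)// mulr_natl mulr2n ltrD.
    by move=> k /=; rewrite mxE.
  apply: countable_bigcupT_measurable => [|u]; first exact: countableP.
  case: asboolP => // _.
  rewrite (_ : box u = [set x | forall k,
      `|(map_mx ratr u.1 : 'rV[R]_m) 0 k - L x 0 k| < u.2.+1%:R^-1]).
    exact: mbox.
  by apply/seteqP; split => x /= h k; have := h k; rewrite mxE.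
apply: (measurability _ (RGenOInfty.measurableE R)) => //.
move=> /= _ [_ [a ->] <-]; rewrite setTI.
have := mopen (psi @^-1` `]a, +oo[).
apply; apply: open_comp => //; exact: interval_open.
Qed.

Section Cylinder.
Variables (R : realType) (d : nat).
Local Notation MeasRd := (MeasRd R d).
Local Notation Rd := (Rd R d).

Lemma open_measurable_Rd (O : set 'rV[R]_d) : open O -> measurable (O : set Rd).
Proof. by move=> oO; exact: sub_gen_smallest. Qed.

Lemma continuous_measurable_Rd (f : 'rV[R]_d -> R) : continuous f ->
  measurable_fun [set: Rd] (f : Rd -> R).
Proof.
move=> cf; apply: (measurability _ (RGenOInfty.measurableE R)) => //.
move=> /= _ [_ [a ->] <-]; rewrite setTI; apply: open_measurable_Rd.
by apply: open_comp => //; exact: interval_open.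
Qed.

Lemma compact_measurable_Rd (K : set 'rV[R]_d) : compact K -> measurable (K : set Rd).
Proof.
move=> /compact_closed cK; rewrite -[K]setCK; apply: measurableC.
by apply: open_measurable_Rd; apply: closed_openC; apply: cK; exact: norm_hausdorff.
Qed.

Lemma measurable_PK (K : set 'rV[R]_d) : compact K -> measurable (PK K).
Proof.
move=> /compact_measurable_Rd mK.
have mev (A : set Rd) (a : \bar R) : measurable A -> measurable [set mu : MeasRd | mu A = a].
  move=> mA; rewrite -[X in measurable X]setTI.
  exact: (measurable_giry_ev mA measurableT (emeasurable_set1 a)).
by apply: measurableI; apply: mev => //; exact: measurableC.
Qed.

(** The integral of a nonnegative function is measurable in the measure, so [g] is shifted by its
    bound [C]. What is subtracted afterwards is [C] times the mass, which varies with [mu] because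
    these are subprobabilities. *)
Lemma bmf_Rintegral_giry (g : Rd -> R) : bmf g ->
  bmf (fun mu : MeasRd => Rintegral mu [set: Rd] g).
Proof.
move=> bg; have [mg [C hC]] := bg.
have C0 : 0 <= C by apply: le_trans (hC 0).
have mass (mu : MeasRd) : 0 <= fine (mu [set: Rd]) <= 1.
  apply/andP; split; first exact: fine_ge0.
  rewrite -lee_fin fineK ?fin_num_measure//; exact: sprobability_setT.
split; last first.
  exists C => mu; apply: le_trans (le_normr_Rintegral measurableT (bmf_integrable mu bg)) _.
  apply: (@le_trans _ _ (Rintegral mu [set: Rd] (fun=> C))).
    apply: Rint_le => //; last exact: bmf_cst.
    by split; [exact: measurableT_comp|exists C => x; rewrite normr_id].
  by rewrite Rintegral_cst// ler_piMr//; case/andP: (mass mu).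
have -> : (fun mu : MeasRd => Rintegral mu [set: Rd] g) =
   (fun mu : MeasRd => fine (giry_int mu (fun x => (g x + C)%:E)) - C * fine (giry_ev mu [set: Rd])).
  apply/funext => mu; rewrite /giry_int -/(Rintegral mu setT (fun x => g x + C)).
  by rewrite RintD ?Rintegral_cst ?addrK//; exact: bmf_cst.
apply: measurable_funB.
  apply: measurableT_comp => //; apply: measurable_giry_int.
    by apply/measurable_EFinP; exact: measurable_funD.
  by move=> x; rewrite lee_fin; have := hC x; rewrite ler_norml; lra.
apply: measurable_funM => //; apply: measurableT_comp => //.
exact: measurable_giry_ev.
Qed.

End Cylinder.

Lemma Rintegral_on d (T : measurableType d) (R : realType) (mu : {measure set T -> \bar R})
    (D : set T) (f : T -> R) :
  Rintegral mu D f = Rintegral mu [set: T] (fun x => \1_D x * f x).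
Proof.
rewrite Rintegral_mkcond; apply: eq_Rintegral => x _.
by rewrite patchE indicE; case: ifP => _; rewrite (mul1r, mul0r).
Qed.

(** Young's inequality leaves a quarter of [s |u|^2] and a quarter of [lam u^T A u]; both are
    absorbed by [bform H u u], half of which survives. The constant 4 is [2 / s] at the worst value
    [s = 1/2]. *)
Lemma ls_error (R : realFieldType) n (H A : 'M[R]_n) (lam s : R) (eta a u : 'rV[R]_n) :
  psd A -> 0 <= lam -> 1 / 2 <= s ->
  s * bform 1%:M u u <= bform H u u -> lam * bform A u u <= bform H u u ->
  bform H u u <= bform 1%:M eta u - lam * bform A a u ->
  bform 1%:M u u <= 2 * bform 1%:M eta eta / s ^+ 2 + 4 * (lam * bform A a a).
Proof.
move=> pA lam0 s2 hs hA hu; have s0 : 0 < s by lra.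
have pI : psd (1%:M : 'M[R]_n) by exact: psd_scalar.
have e1 : bform 1%:M eta u <= bform 1%:M eta eta / s + s * bform 1%:M u u / 4.
  have := pI.2 (eta + (- (s / 2)) *: u).
  rewrite bformDl !bformDr !bformZl !bformZr (bformC u eta pI.1) => h.
  rewrite -(ler_pM2l s0) mulrDr [s * (_ / s)]mulrCA divff ?gt_eqF// mulr1; lra.
have e2 : - (lam * bform A a u) <= lam * bform A a a + lam * bform A u u / 4.
  have := mulr_ge0 lam0 (pA.2 (a + (1 / 2) *: u)).
  rewrite bformDl !bformDr !bformZl !bformZr (bformC u a pA.1); lra.
have b0 : 0 <= lam * bform A a a by rewrite mulr_ge0// pA.2.
set al := bform 1%:M eta eta in e1 *; set be := lam * bform A a a in b0 e2 *.
have e3 : s * bform 1%:M u u <= 2 * (al / s) + 2 * be by lra.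
have -> : 2 * al / s ^+ 2 = 2 * (al / s) / s by rewrite expr2 invfM; ring.
have : bform 1%:M u u <= (2 * (al / s) + 2 * be) / s by rewrite ler_pdivlMr// mulrC.
move=> /le_trans; apply; rewrite mulrDl lerD2l ler_pdivrMr//; nra.
Qed.

(** The first-order condition with the limit [t -> 0] replaced by one explicit [t], small enough for
    [t * q] to be at most [- x / 2]. *)
Lemma ge0_of_quadratic (R : realFieldType) (x q : R) :
  (forall t, 0 < t -> 0 <= t * x + t ^+ 2 * q) -> 0 <= x.
Proof.
move=> h; rewrite leNgt; apply/negP => x0.
have q0 : 0 < `|q| + 1 by rewrite ltr_wpDl.
have t0 : 0 < - x / (2 * (`|q| + 1)) by rewrite divr_gt0 ?oppr_gt0// mulr_gt0.
have := h _ t0; set t := _ / _ in t0 * => ht.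
have : 0 <= x + t * q by rewrite -(pmulr_rge0 _ t0) mulrDr mulrA -expr2.
have : t * q <= t * (`|q| + 1) by rewrite ler_wpM2l ?(ltW t0)// (le_trans (ler_norm q))// lerDl.
have -> : t * (`|q| + 1) = - x / 2 by rewrite /t invfM; field; rewrite gt_eqF.
lra.
Qed.

(** * Cylinder functions, their energies and Gram matrices *)

Section Cylinder.
Variables (R : realType) (d : nat).
Local Notation MeasRd := (MeasRd R d).
Local Notation Rd := (Rd R d).
Variable K : set 'rV[R]_d.
Hypothesis cK : compact K.
Let mK := compact_measurable_Rd cK.
Implicit Types (G : cylinder R d) (mu : MeasRd).

Lemma C1b_bmf (f : 'rV[R]_d -> R) : C1b f -> bmf (f : Rd -> R).
Proof. by move=> [cf [hC _]]; split=> //; exact: continuous_measurable_Rd. Qed.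

Lemma C1b_pd_bmf (f : 'rV[R]_d -> R) i : C1b f -> bmf (pd f i : Rd -> R).
Proof.
move=> [_ [_ /(_ i)[_ [cf hC]]]]; split=> //; exact: continuous_measurable_Rd.
Qed.

Lemma cyl_L_bmf G k : bmf (fun mu => cyl_L G mu 0 k).
Proof.
under eq_fun do rewrite mxE; apply: bmf_Rintegral_giry; apply: C1b_bmf.
exact: cyl_phiC.
Qed.

Lemma cyl_eval_bmf G : bmf (cyl_eval G).
Proof.
have [cpsi [[C hC] _]] := cyl_psiC G; split; last by exists C => mu; exact: hC.
apply: (continuous_comp_row_measurable (L := cyl_L G)) => // k.
by have [] := cyl_L_bmf k.
Qed.

Lemma cyl_pd_bmf G i : bmf (fun mu => pd (cyl_psi (c:=G)) i (cyl_L G mu)).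
Proof.
have [_ [_ /(_ i)[_ [cpsi [C hC]]]]] := cyl_psiC G; split; last by exists C => mu; exact: hC.
apply: (continuous_comp_row_measurable (L := cyl_L G)) => // k.
by have [] := cyl_L_bmf k.
Qed.

Lemma cyl_DE G mu x j : cyl_D G mu x 0 j =
  \sum_k pd (cyl_psi (c:=G)) k (cyl_L G mu) * pd (cyl_phi (c:=G) k) j x.
Proof. by rewrite summxE; apply: eq_bigr => k _; rewrite !mxE. Qed.

Lemma cyl_D_bmf G mu j : bmf (fun x : Rd => cyl_D G mu x 0 j).
Proof.
under eq_fun do rewrite cyl_DE; apply: bmf_sum => k; apply: bmfZ.
by apply: C1b_pd_bmf; exact: cyl_phiC.
Qed.

Lemma dotv_bmf (U V : Rd -> 'rV[R]_d) : (forall j, bmf (fun x => U x 0 j)) ->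
  (forall j, bmf (fun x => V x 0 j)) -> bmf (fun x => dotv (U x) (V x)).
Proof. by move=> bU bV; apply: bmf_sum => j; exact: bmfM. Qed.

Let bK : bmf (\1_(K : set Rd) : Rd -> R) := bmf_indic R mK.

(** The integrand depends on [mu] as well as on [x]. Expanding both gradients separates the
    variables: the result is a finite sum of coefficients in [mu] times integrals of fixed functions
    of [x]. *)
Lemma innerCE_bmf G H : bmf (innerCE K (cyl_D G) (cyl_D H)).
Proof.
pose a k mu := pd (cyl_psi (c:=G)) k (cyl_L G mu).
pose b k mu := pd (cyl_psi (c:=H)) k (cyl_L H mu).
pose f k j (x : Rd) := pd (cyl_phi (c:=G) k) j x.
pose g k j (x : Rd) := pd (cyl_phi (c:=H) k) j x.
have bf k j : bmf (f k j) by apply: C1b_pd_bmf; exact: cyl_phiC.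
have bg k j : bmf (g k j) by apply: C1b_pd_bmf; exact: cyl_phiC.
have bfg k l j : bmf (fun x => \1_(K : set Rd) x * (f k j x * g l j x)).
  by apply: bmfM => //; exact: bmfM.
apply: (bmf_ext (f := fun mu => \sum_j \sum_k \sum_l a k mu * b l mu *
   Rintegral mu [set: Rd] (fun x => \1_(K : set Rd) x * (f k j x * g l j x)))); last first.
  apply: bmf_sum => j; apply: bmf_sum => k; apply: bmf_sum => l; apply: bmfM.
    by apply: bmfM; exact: cyl_pd_bmf.
  exact: bmf_Rintegral_giry.
move=> mu; rewrite /innerCE Rintegral_on.
transitivity (Rintegral mu [set: Rd] (fun x => \sum_j \sum_k \sum_l
   a k mu * b l mu * (\1_(K : set Rd) x * (f k j x * g l j x)))).
  rewrite Rint_sum; last by move=> j; do 2 (apply: bmf_sum => ?); exact: bmfZ.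
  apply: eq_bigr => j _; rewrite Rint_sum; last by move=> k; apply: bmf_sum => ?; exact: bmfZ.
  apply: eq_bigr => k _; rewrite Rint_sum; last by move=> ?; exact: bmfZ.
  by apply: eq_bigr => l _; rewrite RintZ.
apply: eq_Rintegral => x _; rewrite mulr_sumr; apply: eq_bigr => j _.
rewrite !cyl_DE mulr_suml mulr_sumr; apply: eq_bigr => k _.
rewrite mulr_sumr mulr_sumr; apply: eq_bigr => l _.
by rewrite /a /b /f /g; ring.
Qed.

Lemma innerCE_C G H mu : innerCE K (cyl_D G) (cyl_D H) mu = innerCE K (cyl_D H) (cyl_D G) mu.
Proof.
by apply: eq_Rintegral => x _; apply: eq_bigr => j _; rewrite mulrC.
Qed.

Section Family.
Variables (n : nat) (l : 'I_n -> cylinder R d).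

Definition rowf (c : 'I_n -> R) : 'rV[R]_n := \row_i c i.

Definition gramE mu : 'M[R]_n := \matrix_(i, k) (cyl_eval (l i) mu * cyl_eval (l k) mu).
Definition gramD mu : 'M[R]_n := \matrix_(i, k) innerCE K (cyl_D (l i)) (cyl_D (l k)) mu.

Lemma bform_gramE mu c c' :
  bform (gramE mu) (rowf c) (rowf c') = vn_eval l c mu * vn_eval l c' mu.
Proof.
rewrite bformE /vn_eval mulr_suml; apply: eq_bigr => i _.
by rewrite mulr_sumr; apply: eq_bigr => k _; rewrite !mxE; ring.
Qed.

Lemma bform_gramD mu c c' :
  bform (gramD mu) (rowf c) (rowf c') = innerCE K (vn_D l c) (vn_D l c') mu.
Proof.
have bDD i k : bmf (fun x : Rd => dotv (cyl_D (l i) mu x) (cyl_D (l k) mu x)).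
  by apply: dotv_bmf => j; exact: cyl_D_bmf.
have bKDD i k : bmf (fun x : Rd => \1_(K : set Rd) x * dotv (cyl_D (l i) mu x) (cyl_D (l k) mu x)).
  exact: bmfM.
rewrite bformE /innerCE Rintegral_on.
transitivity (Rintegral mu [set: Rd] (fun x => \sum_i \sum_k
   c i * c' k * (\1_(K : set Rd) x * dotv (cyl_D (l i) mu x) (cyl_D (l k) mu x)))).
  rewrite Rint_sum; last by move=> i; apply: bmf_sum => k; exact: bmfZ.
  apply: eq_bigr => i _; rewrite Rint_sum; last by move=> k; exact: bmfZ.
  apply: eq_bigr => k _; rewrite RintZ// !mxE /innerCE Rintegral_on; ring.
apply: eq_Rintegral => x _.
transitivity (\1_(K : set Rd) x * \sum_j \sum_i \sum_k
    (c i * cyl_D (l i) mu x 0 j) * (c' k * cyl_D (l k) mu x 0 j)).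
  rewrite [in RHS]exchange_big mulr_sumr; apply: eq_bigr => i _.
  rewrite [in RHS]exchange_big mulr_sumr; apply: eq_bigr => k _.
  by rewrite /dotv !mulr_sumr; apply: eq_bigr => j _; ring.
congr (_ * _); apply: eq_bigr => j _.
rewrite !summxE mulr_suml; apply: eq_bigr => i _.
by rewrite mulr_sumr; apply: eq_bigr => k _; rewrite !mxE.
Qed.

Lemma rowf_surj (v : 'rV[R]_n) : v = rowf (fun i => v 0 i).
Proof. by apply/rowP => i; rewrite mxE. Qed.

Lemma psd_gramE mu : psd (gramE mu).
Proof.
split; first by apply/matrixP => i k; rewrite !mxE mulrC.
by move=> v; rewrite (rowf_surj v) bform_gramE -expr2 sqr_ge0.
Qed.

Lemma psd_gramD mu : psd (gramD mu).
Proof.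
split; first by apply/matrixP => i k; rewrite !mxE innerCE_C.
move=> v; rewrite (rowf_surj v) bform_gramD; apply: Rintegral_ge0 => x _.
by apply: sumr_ge0 => j _; rewrite -expr2 sqr_ge0.
Qed.

Lemma vn_eval_bmf c : bmf (vn_eval l c).
Proof. by apply: bmf_sum => i; apply: bmfZ; exact: cyl_eval_bmf. Qed.

Lemma bform_gramD_bmf u v : bmf (fun mu => bform (gramD mu) u v).
Proof.
under eq_fun do rewrite bformE; apply: bmf_sum => i; apply: bmf_sum => k.
apply: bmfM; last exact: bmf_cst.
by apply: bmfZ; under eq_fun do rewrite mxE; exact: innerCE_bmf.
Qed.

(** A real supremum bounds its members only when the set is bounded; cylinder functions and their
    energies are bounded over all measures. *)
Lemma trace_gram_le_Klam lam mu : PK K mu -> \tr (gramE mu + lam *: gramD mu) <= Klam K l lam.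
Proof.
move=> Kmu.
have b i : bmf (fun mu => cyl_eval (l i) mu ^+ 2 + lam * innerCE K (cyl_D (l i)) (cyl_D (l i)) mu).
  apply: bmfD; first by apply: bmfX; exact: cyl_eval_bmf.
  by apply: bmfZ; exact: innerCE_bmf.
have [_ [C hC]] := bmf_sum (index_enum 'I_n) b.
have -> : \tr (gramE mu + lam *: gramD mu) =
  \sum_i (cyl_eval (l i) mu ^+ 2 + lam * innerCE K (cyl_D (l i)) (cyl_D (l i)) mu).
  by apply: eq_bigr => i _; rewrite !mxE expr2.
apply: ub_le_sup; last by exists mu.
by exists C => _ [nu _ <-]; apply: le_trans (hC nu); exact: ler_norm.
Qed.

End Family.
End Cylinder.

(** * Least squares *)

Section CDelta.
Variable R : realType.
Implicit Types x y : R.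

Lemma ln_ge_1BV x : 0 < x -> 1 - x^-1 <= ln x.
Proof.
move=> x0; have := @le_ln1Dx R (x^-1 - 1).
rewrite addrCA subrr addr0 lnV ?posrE// => /(_ _); rewrite ltrBrDl subrr invr_gt0 => /(_ x0); lra.
Qed.

(** Convexity in tangent form, the derivative being [ln (1 + y)]. It is [ln z >= 1 - 1/z] at
    [z = (1 + x) / (1 + y)], multiplied by [1 + x]. *)
Lemma cdelta_tangent x y : 0 <= x -> 0 <= y ->
  cdelta y + ln (1 + y) * (x - y) <= cdelta x.
Proof.
move=> x0 y0; have x1 : 0 < 1 + x by lra.
have y1 : 0 < 1 + y by lra.
have := @ln_ge_1BV ((1 + x) / (1 + y)); rewrite divr_gt0// => /(_ isT).
rewrite ln_div ?posrE// invf_div => /(ler_wpM2l (ltW x1)).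
rewrite mulrBr mulr1 mulrCA divff ?gt_eqF// mulr1 /cdelta; lra.
Qed.

Lemma cdelta0 : cdelta (0 : R) = 0.
Proof. by rewrite /cdelta addr0 ln1 mulr0 subr0. Qed.

(** The tangent at 0 is flat and yields only nonnegativity; the tangent at [x / 2] has positive
    slope and makes the inequality strict. *)
Lemma cdelta_gt0 x : 0 < x -> 0 < cdelta x.
Proof.
move=> x0; have x1 : 0 < 1 + x by lra.
have := @cdelta_tangent x (x / 2) (ltW x0); rewrite divr_ge0 ?(ltW x0)// => /(_ isT).
have := @cdelta_tangent 0 (x / 2) (lexx _); rewrite cdelta0 divr_ge0 ?(ltW x0)// => /(_ isT) h0.
have := @cdelta_tangent (x / 2) 0; rewrite divr_ge0 ?(ltW x0)// cdelta0 addr0 ln1 mul0r addr0.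
move=> /(_ isT (lexx _)) h1 h2.
have : 0 < ln (1 + x / 2) by rewrite ln_gt0//; lra.
nra.
Qed.

(** The tangent at [t * x], evaluated at [x] and at 0 and averaged with weights [t] and [1 - t];
    [cdelta] vanishes at 0. *)
Lemma cdelta_scale x t : 0 <= x -> 0 <= t -> t <= 1 -> cdelta (t * x) <= t * cdelta x.
Proof.
move=> x0 t0 t1; have tx0 : 0 <= t * x by rewrite mulr_ge0.
have h1 := cdelta_tangent x0 tx0.
have h2 := cdelta_tangent (lexx 0) tx0; rewrite cdelta0 in h2.
have := ler_wpM2l t0 h1; have t1' : 0 <= 1 - t by lra.
have := ler_wpM2l t1' h2; nra.
Qed.

(* Summing the tangent inequality along a subdivision bounds [cdelta x] by Riemann sums
   of its derivative [ln (1 + y) <= y]. *)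
Lemma cdelta_le x : 0 <= x -> cdelta x <= x ^+ 2 / 2.
Proof.
move=> x0; have H (h : R) k : 0 <= h -> cdelta (k%:R * h) <= h ^+ 2 * (k%:R * k.+1%:R) / 2.
  move=> h0; elim: k => [|k IH]; first by rewrite !mul0r cdelta0 mulr0 mul0r.
  have kh0 : 0 <= k%:R * h by rewrite mulr_ge0.
  have k1h0 : 0 <= k.+1%:R * h by rewrite mulr_ge0.
  have := cdelta_tangent kh0 k1h0.
  have : ln (1 + k.+1%:R * h) <= k.+1%:R * h by apply: le_ln1Dx; lra.
  move=> /(ler_wpM2l h0); rewrite -(natr1 k.+1) -(natr1 k) => h1 h2.
  rewrite -(natr1 k) in IH; nra.
apply/ler_addgt0Pr => e e0.
pose m := (Num.truncn (x ^+ 2 / e)).+1.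
have m0 : 0 < m%:R :> R by rewrite ltr0n.
have hm : x ^+ 2 / e < m%:R by exact: truncnS_gt.
have e1 : m%:R * (x / m%:R) = x by rewrite mulrC divfK ?gt_eqF.
have := H (x / m%:R) m; rewrite e1 divr_ge0// => /(_ isT) /le_trans; apply.
have -> : (x / m%:R) ^+ 2 * (m%:R * m.+1%:R) / 2 = x ^+ 2 / 2 + x ^+ 2 / m%:R / 2.
  by rewrite -(natr1 m) expr2; field; rewrite gt_eqF.
rewrite lerD2l; rewrite ltr_pdivrMr// in hm.
have : x ^+ 2 / m%:R < e by rewrite ltr_pdivrMr// mulrC.
lra.
Qed.

Lemma ln_nat_ge_half (N : nat) : (2 <= N)%N -> 1 / 2 <= ln (N%:R : R).
Proof.
move=> N2; have N2R : 2 <= N%:R :> R by rewrite ler_nat.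
apply: le_trans (ln_ge_1BV _); last by lra.
have : N%:R^-1 <= 2^-1 :> R by rewrite lef_pV2 ?posrE//; lra.
lra.
Qed.

End CDelta.

(** * Second moment of a sum of independent centred variables *)

Section Variance.
Context dO dT (Omega : measurableType dO) (T : measurableType dT) (R : realType).
Variables (P : probability Omega R) (p : probability T R) (N : nat).
Variable X : 'I_N -> Omega -> T.
Hypothesis mX : forall j, measurable_fun [set: Omega] (X j).
Hypothesis iidX : forall A : 'I_N -> set T, (forall j, measurable (A j)) ->
  P [set w | forall j, A j (X j w)] = (\prod_(j < N) fine (p (A j)))%:E.

Local Notation EP := (Rintegral P [set: Omega]).
Local Notation Ep := (Rintegral p [set: T]).

Lemma Rint_sample j f : bmf f -> EP (fun w => f (X j w)) = Ep f.
Proof.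
move=> bf; have := Rint_span_off mX iidX (j := j) bf (span_off_cst X j 1).
by rewrite Rint_cst mulr1; under eq_Rintegral do rewrite mulr1.
Qed.

Lemma Rint_sum_sqr f : bmf f -> Ep f = 0 ->
  EP (fun w => (\sum_j f (X j w)) ^+ 2) = N%:R * Ep (fun x => f x ^+ 2).
Proof.
move=> bf f0; have bX j : bmf (fun w => f (X j w)) by exact: bmf_comp.
under eq_Rintegral do rewrite expr2 mulr_suml.
rewrite (Rint_sum _ _ (F := fun j w => f (X j w) * \sum_k f (X k w))); last first.
  by move=> j; apply: bmfM => //; exact: bmf_sum.
rewrite (eq_bigr (fun=> Ep (fun x => f x ^+ 2))).
  by rewrite sumr_const card_ord mulr_natl.
move=> j _; under eq_Rintegral do rewrite mulr_sumr.
rewrite (Rint_sum _ _ (F := fun k w => f (X j w) * f (X k w))); last by move=> k; exact: bmfM.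
rewrite (bigD1 j)//= [X in _ + X]big1 ?addr0.
  rewrite -(Rint_sample j) //; exact: bmfX.
move=> k kj; rewrite (Rint_span_off mX iidX (j := j) bf) ?f0 ?mul0r//.
exact: (@span_off_gen _ _ _ _ _ _ X j k f).
Qed.

End Variance.

Section LeastSquares.
Variables (R : realType) (d : nat) (K : set 'rV[R]_d) (n N : nat).
Hypothesis cK : compact K.
Variables (l : 'I_n -> cylinder R d) (mus : 'I_N -> MeasRd R d) (F : MeasRd R d -> R) (lam : R).

Lemma vn_eval_lin c u (t : R) mu :
  vn_eval l (fun i => c i + t * u i) mu = vn_eval l c mu + t * vn_eval l u mu.
Proof.
by rewrite /vn_eval mulr_sumr -big_split/=; apply: eq_bigr => i _; ring.
Qed.

Lemma rowf_lin (c u : 'I_n -> R) t : rowf (fun i => c i + t * u i) = rowf c + t *: rowf u.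
Proof. by apply/rowP => i; rewrite !mxE. Qed.

(** Optimality of [c] against [c - t u]: the objective changes by [2 x t + q t^2], where [x] is the
    right side minus the left side and [q] is the left side. The factor [1 * u i] gives [c] the
    shape required by [vn_eval_lin] and [rowf_lin]. *)
Lemma ls_minimizer_ineq (c a u : 'I_n -> R) : (forall i, c i = a i + 1 * u i) ->
  (forall c', L2_emp mus F (vn_eval l c) + lam * pCE_emp K mus (vn_D l c)
     <= L2_emp mus F (vn_eval l c') + lam * pCE_emp K mus (vn_D l c')) ->
  N%:R^-1 * \sum_j bform (gramE l (mus j) + lam *: gramD K l (mus j)) (rowf u) (rowf u) <=
  N%:R^-1 * (\sum_j (F (mus j) - vn_eval l a (mus j)) * vn_eval l u (mus j)) -
    lam * (N%:R^-1 * \sum_j bform (gramD K l (mus j)) (rowf a) (rowf u)).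
Proof.
move=> /funext cE cmin; rewrite -subr_ge0.
pose I j := bform (gramD K l (mus j)).
under [X in _ - _ * X]eq_bigr do rewrite bformMD bformMZ bform_gramE -expr2 -/(I _).
set q := N%:R^-1 * \sum_j (_ + _).
set x := _ - _; suff : 0 <= 2 * x by lra.
apply: (@ge0_of_quadratic _ _ q) => t _.
have := cmin (fun i => c i + (- t) * u i); rewrite -subr_ge0.
rewrite /L2_emp /pCE_emp; congr (0 <= _).
have -> : x = N%:R^-1 * \sum_j ((F (mus j) - vn_eval l a (mus j)) * vn_eval l u (mus j)
    - lam * I j (rowf a) (rowf u) - vn_eval l u (mus j) ^+ 2 - lam * I j (rowf u) (rowf u)).
  by rewrite /x /q !sumrB big_split/= -!mulr_sumr /I; ring.
rewrite /q.
rewrite ![lam * (_ * _)]mulrCA ![_ * (N%:R^-1 * _)]mulrCA -!mulrDr -mulrBr; congr (_ * _).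
rewrite !mulr_sumr -!big_split/= -sumrB; apply: eq_bigr => j _.
rewrite -!(bform_gramD cK) -/(I j) cE !vn_eval_lin !rowf_lin.
rewrite /I !(bformDl, bformDr, bformZl, bformZr) (bformC (rowf u) (rowf a) (psd_gramD cK l (mus j)).1).
ring.
Qed.

End LeastSquares.

(** * Population Gram matrix and its normalisation *)

Section Population.
Variables (R : realType) (d : nat) (K : set 'rV[R]_d).
Variables (p : probability (MeasRd R d) R) (lam : R) (n : nat) (l : 'I_n -> cylinder R d).
Hypotheses (cK : compact K) (pK : p (PK K) = 1%E) (lam0 : 0 <= lam) (n0 : (0 < n)%N).
Hypothesis orthoE : forall i j : 'I_n, L2ip K p (cyl_eval (l i)) (cyl_eval (l j)) = (i == j)%:R.
Hypothesis orthoD : forall i j : 'I_n, i != j -> pCE_p K p (cyl_D (l i)) (cyl_D (l j)) = 0.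

Local Notation Ep := (Rintegral p [set: MeasRd R d]).
(** Turns integrals over [PK K] into integrals over the whole space, and makes [F], which is
    controlled only on [PK K], a bounded measurable function. *)
Definition chi (mu : MeasRd R d) : R := \1_(PK K) mu.
Let mPK := measurable_PK cK.

Lemma chi_bmf : bmf chi. Proof. exact: bmf_indic. Qed.

Lemma chi1 mu : PK K mu -> chi mu = 1.
Proof. by move=> h; rewrite /chi indicE mem_set. Qed.

Lemma chi_ge0 mu : 0 <= chi mu. Proof. exact: ler0n. Qed.

Lemma chi_le1 mu : chi mu <= 1.
Proof. by rewrite /chi indicE lern1 leq_b1. Qed.

Lemma chi_sqr mu : chi mu ^+ 2 = chi mu.
Proof. by rewrite /chi indicE; case: (_ \in _); rewrite ?expr1n ?expr0n. Qed.

Lemma chi_case mu : PK K mu \/ chi mu = 0.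
Proof.
by have [?|?] := pselect (PK K mu); [left|right; rewrite /chi indicE memNset].
Qed.

Lemma Ep_chi : Ep chi = 1.
Proof. by rewrite /chi Rint_indic// pK. Qed.

Lemma Rint_PK f : Rintegral p (PK K) f = Ep (fun mu => chi mu * f mu).
Proof. exact: Rintegral_on. Qed.

Definition gram mu : 'M[R]_n := gramE l mu + lam *: gramD K l mu.

Lemma psd_gram mu : psd (gram mu).
Proof. by apply: psdD; [exact: psd_gramE|apply: psdZ => //; exact: psd_gramD]. Qed.

Lemma gram_bmf i k : bmf (fun mu => gram mu i k).
Proof.
apply: (bmf_ext (f := fun mu => cyl_eval (l i) mu * cyl_eval (l k) mu +
    lam * innerCE K (cyl_D (l i)) (cyl_D (l k)) mu)).
  by move=> mu; rewrite !mxE.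
apply: bmfD; first by apply: bmfM; exact: cyl_eval_bmf.
by apply: bmfZ; exact: innerCE_bmf.
Qed.

Definition pce i := pCE_p K p (cyl_D (l i)) (cyl_D (l i)).

Lemma pce_ge0 i : 0 <= pce i.
Proof.
apply: Rintegral_ge0 => mu _; apply: Rintegral_ge0 => x _.
by apply: sumr_ge0 => j _; rewrite -expr2 sqr_ge0.
Qed.

Definition sigma i := 1 + lam * pce i.

Lemma sigma_ge1 i : 1 <= sigma i.
Proof. by rewrite /sigma lerDl mulr_ge0// pce_ge0. Qed.

Lemma sigma_gt0 i : 0 < sigma i.
Proof. exact: lt_le_trans (sigma_ge1 i). Qed.

Lemma Ep_gram i k : Ep (fun mu => chi mu * gram mu i k) = (i == k)%:R * sigma i.
Proof.
have b1 : bmf (fun mu => chi mu * (cyl_eval (l i) mu * cyl_eval (l k) mu)).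
  by apply: bmfM; [exact: chi_bmf|apply: bmfM; exact: cyl_eval_bmf].
have b2 : bmf (fun mu => chi mu * innerCE K (cyl_D (l i)) (cyl_D (l k)) mu).
  by apply: bmfM; [exact: chi_bmf|exact: innerCE_bmf].
transitivity (Ep (fun mu => chi mu * (cyl_eval (l i) mu * cyl_eval (l k) mu) +
    lam * (chi mu * innerCE K (cyl_D (l i)) (cyl_D (l k)) mu))).
  by apply: eq_Rintegral => mu _; rewrite !mxE; ring.
rewrite RintD//; last exact: bmfZ.
rewrite RintZ// -!Rint_PK.
have := orthoE i k; rewrite /L2ip => ->.
have [<-|ik] := eqVneq i k; first by rewrite mul1r.
by have := orthoD ik; rewrite /pCE_p => ->; rewrite mulr0 addr0 mul0r.
Qed.

Definition mu_min := inf (range pce).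
Definition mu_max := sup (range pce).

Lemma pce_range_finite : exists C, forall i, pce i <= C.
Proof.
exists (\sum_i pce i) => i; rewrite (bigD1 i)//= lerDl sumr_ge0// => j _.
exact: pce_ge0.
Qed.

Lemma mu_min_le i : mu_min <= pce i.
Proof.
apply: ge_inf; last by exists i.
by exists 0 => _ [j _ <-]; exact: pce_ge0.
Qed.

Lemma mu_max_ge i : pce i <= mu_max.
Proof.
have [C hC] := pce_range_finite.
apply: ub_le_sup; last by exists i.
by exists C => _ [j _ <-].
Qed.

Let i0 : 'I_n := Ordinal n0.

Lemma mu_min_ge0 : 0 <= mu_min.
Proof.
apply: lb_le_inf; first by exists (pce i0), i0.
by move=> _ [j _ <-]; exact: pce_ge0.
Qed.

Definition smin := 1 + lam * mu_min.
Definition smax := 1 + lam * mu_max.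

Lemma smin_ge1 : 1 <= smin. Proof. by rewrite lerDl mulr_ge0// mu_min_ge0. Qed.

Lemma smin_le i : smin <= sigma i.
Proof. by rewrite lerD2l ler_wpM2l// mu_min_le. Qed.

Lemma smax_ge i : sigma i <= smax.
Proof. by rewrite lerD2l ler_wpM2l// mu_max_ge. Qed.

Lemma smin_smax : smin <= smax.
Proof. exact: le_trans (smin_le i0) (smax_ge i0). Qed.

Local Notation Kl := (Klam K l lam).

(** The trace of [gram] is at most [Kl] on [PK K], and its mean is the sum of the [sigma i]. This is
    what later bounds the dimension [n] in terms of [N]. *)
Lemma Klam_ge : n%:R * smin <= Kl.
Proof.
have bt : bmf (fun mu => chi mu * \tr (gram mu)).
  by apply: bmfM; [exact: chi_bmf|apply: bmf_sum => i; exact: gram_bmf].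
have : Ep (fun mu => chi mu * \tr (gram mu)) <= Ep (fun mu => Kl * chi mu).
  apply: Rint_le => //; first by apply: bmfZ; exact: chi_bmf.
  move=> mu; have [h|->] := chi_case mu; last by rewrite mul0r mulr0.
  by rewrite chi1// mul1r mulr1; exact: trace_gram_le_Klam.
rewrite RintZ ?Ep_chi ?mulr1; last exact: chi_bmf.
apply: le_trans.
under eq_Rintegral do rewrite /mxtrace mulr_sumr.
rewrite (Rint_sum _ _ (F := fun i mu => chi mu * gram mu i i)); last first.
  by move=> i; apply: bmfM; [exact: chi_bmf|exact: gram_bmf].
rewrite -[X in X%:R](card_ord n) mulr_natl -sumr_const; apply: ler_sum => i _.
by rewrite Ep_gram eqxx mul1r smin_le.
Qed.

Lemma Klam_gt0 : 0 < Kl.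
Proof.
apply: lt_le_trans Klam_ge; rewrite mulr_gt0// ?ltr0n//.
exact: lt_le_trans smin_ge1.
Qed.

(* [gram], set to zero off [PK K] and rescaled to have mean the identity. *)
Definition ngram mu : 'M[R]_n :=
  \matrix_(i, k) (chi mu * gram mu i k / (Num.sqrt (sigma i) * Num.sqrt (sigma k))).

Lemma sqrt_sigma_gt0 i : 0 < Num.sqrt (sigma i).
Proof. by rewrite sqrtr_gt0 sigma_gt0. Qed.

Lemma ngram_bmf i k : bmf (fun mu => ngram mu i k).
Proof.
apply: (bmf_ext (f := fun mu => chi mu * gram mu i k *
   (Num.sqrt (sigma i) * Num.sqrt (sigma k))^-1)); first by move=> mu; rewrite [RHS]mxE.
apply: bmfM; last exact: bmf_cst.
by apply: bmfM; [exact: chi_bmf|exact: gram_bmf].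
Qed.

Lemma bform_ngram mu (v : 'rV[R]_n) :
  bform (ngram mu) v v = chi mu *
    bform (gram mu) (\row_i (v 0 i / Num.sqrt (sigma i))) (\row_i (v 0 i / Num.sqrt (sigma i))).
Proof.
rewrite !bformE mulr_sumr; apply: eq_bigr => i _; rewrite mulr_sumr; apply: eq_bigr => k _.
have E (x y g c a b : R) : x * (c * g * (a * b)) * y = c * (x * a * g * (y * b)) by ring.
by rewrite [ngram _ _ _]mxE [X in _ = _ * (X * _ * _)]mxE [X in _ = _ * (_ * X)]mxE invfM E.
Qed.

Lemma psd_ngram mu : psd (ngram mu).
Proof.
split.
  apply/matrixP => i k.
  have gC : gram mu k i = gram mu i k by have /matrixP/(_ i k) := (psd_gram mu).1; rewrite mxE.
  by rewrite 2![LHS]mxE [RHS]mxE gC [X in _ / X]mulrC.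
by move=> v; rewrite bform_ngram mulr_ge0 ?chi_ge0// (psd_gram mu).2.
Qed.

(** [gram] is bounded by its trace, hence by [Kl], and the rescaling divides [|v|^2] by at least
    [smin]. *)
Lemma psd_ngram_bound mu : psd ((Kl / smin)%:M - ngram mu).
Proof.
have s0 : 0 < smin by exact: lt_le_trans smin_ge1.
split; first by rewrite linearB /= tr_scalar_mx (psd_ngram mu).1.
move=> v; rewrite bformMD bformMN bform_scalar subr_ge0 bform_ngram.
have B0 := bform1_ge0 v.
have [h|->] := chi_case mu; last by rewrite mul0r mulr_ge0// divr_ge0// ltW// Klam_gt0.
rewrite chi1// mul1r.
apply: (le_trans (bform_le_trace _ (psd_gram mu))).
apply: (@le_trans _ _ (Kl * (smin^-1 * bform 1%:M v v))); last by rewrite mulrA.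
apply: ler_pM; [exact/psd_trace_ge0/psd_gram|exact: bform1_ge0|exact: trace_gram_le_Klam|].
rewrite !bform1 mulr_sumr; apply: ler_sum => i _; rewrite !mxE.
rewrite mulrACA -invfM -!expr2 sqr_sqrtr ?(ltW (sigma_gt0 i))// mulrC ler_wpM2r ?sqr_ge0//.
by rewrite lef_pV2 ?posrE ?sigma_gt0// smin_le.
Qed.

Lemma Ep_ngram i k : Ep (fun mu => ngram mu i k) = (i == k)%:R.
Proof.
transitivity (Ep (fun mu => (Num.sqrt (sigma i) * Num.sqrt (sigma k))^-1 * (chi mu * gram mu i k))).
  by apply: eq_Rintegral => mu _; rewrite [LHS]mxE mulrC.
rewrite RintZ; last by apply: bmfM; [exact: chi_bmf|exact: gram_bmf].
rewrite Ep_gram; have [<-|_] := eqVneq i k; last by rewrite mul0r mulr0.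
by rewrite -expr2 sqr_sqrtr ?(ltW (sigma_gt0 i))// mul1r mulVf// gt_eqF// sigma_gt0.
Qed.

Lemma Klam_smin_ge1 : 1 <= Kl / smin.
Proof.
have s0 : 0 < smin by exact: lt_le_trans smin_ge1.
rewrite ler_pdivlMr// mul1r; apply: le_trans Klam_ge.
by rewrite ler_peMl ?(ltW s0)// ler1n.
Qed.

End Population.

(** * Consequences of the condition on the sample size *)

Section SampleSize.
Variables (R : realType) (N n : nat) (Kl sm sM r : R).
Hypotheses (N2 : (2 <= N)%N) (sm1 : 1 <= sm) (smM : sm <= sM) (nK : n%:R * sm <= Kl).
Hypotheses (K0 : 0 < Kl) (r0 : 0 < r).
Let delta := 1 / (2 * sM).
Hypothesis hN : (1 + r) * Kl / (sm * cdelta delta) <= N%:R / ln N%:R.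

Let L := ln (N%:R : R).
Let L_half : 1 / 2 <= L. Proof. exact: ln_nat_ge_half. Qed.
Let L0 : 0 < L. Proof. by apply: lt_le_trans L_half; lra. Qed.
Let Np : 0 < N%:R :> R. Proof. by rewrite ltr0n (leq_trans _ N2). Qed.
Let sM1 : 1 <= sM. Proof. exact: le_trans smM. Qed.
Let sM0 : 0 < sM. Proof. exact: lt_le_trans sM1. Qed.
Let sm0 : 0 < sm. Proof. exact: lt_le_trans sm1. Qed.

Lemma delta_gt0 : 0 < delta.
Proof. by rewrite divr_gt0// mulr_gt0. Qed.

Lemma delta_le_half : delta <= 1 / 2.
Proof. by rewrite /delta ler_pM2l// lef_pV2 ?posrE ?mulr_gt0// ler_peMr. Qed.

Let c0 : 0 < cdelta delta. Proof. exact: cdelta_gt0 delta_gt0. Qed.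

Let hNc : (1 + r) * Kl * L <= N%:R * (sm * cdelta delta).
Proof. by move: hN; rewrite ler_pdivrMr ?mulr_gt0// mulrAC ler_pdivlMr. Qed.

(** As [cdelta delta <= delta^2 / 2], the exponent is at least [(1 + r) ln N], which gives
    [N^-1 * N^(-r)]. The dimension is removed by [n <= N / 4], a consequence of [n sm <= Kl],
    [ln N >= 1/2] and [cdelta delta <= 1/8]. *)
Lemma bad_event_bound :
  2 * n%:R * expR (- (N%:R * delta ^+ 2 / (2 * (Kl / sm)))) <= N%:R `^ (- r) / 2.
Proof.
have cd := cdelta_le (ltW delta_gt0).
have e1 : (1 + r) * L <= N%:R * delta ^+ 2 / (2 * (Kl / sm)).
  have -> : N%:R * delta ^+ 2 / (2 * (Kl / sm)) = N%:R * (sm * (delta ^+ 2 / 2)) / Kl.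
    by field; rewrite !gt_eqF.
  rewrite ler_pdivlMr// mulrAC; apply: le_trans hNc _.
  by rewrite ler_pM2l// ler_pM2l.
have e2 : n%:R <= N%:R / 4 :> R.
  have c8 : cdelta delta <= 1 / 8.
    apply: le_trans cd _; have d0 := ltW delta_gt0.
    have := ler_pM d0 d0 delta_le_half delta_le_half; rewrite -expr2; lra.
  have h1 : n%:R * sm * L <= N%:R * (sm * (1 / 8)).
    apply: (@le_trans _ _ ((1 + r) * Kl * L)).
      by rewrite ler_pM2r// (le_trans nK)// ler_peMl ?(ltW K0)// lerDl ltW.
    by apply: le_trans hNc _; rewrite ler_pM2l// ler_pM2l.
  have h2 : n%:R * sm * (1 / 2) <= n%:R * sm * L.
    by rewrite ler_wpM2l// mulr_ge0// ltW.
  have h3 : sm * n%:R <= sm * (N%:R / 4) by lra.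
  by rewrite ler_pM2l in h3.
have e3 : expR (- (N%:R * delta ^+ 2 / (2 * (Kl / sm)))) <= N%:R^-1 * N%:R `^ (- r).
  have -> : N%:R^-1 = expR (- L) by rewrite expRN lnK ?posrE.
  rewrite /powR gt_eqF// -expRD ler_expR -/L mulNr -opprD lerN2.
  by move: e1; rewrite mulrDl mul1r.
have p0 : 0 <= N%:R `^ (- r) by exact: powR_ge0.
apply: (@le_trans _ _ (2 * n%:R * (N%:R^-1 * N%:R `^ (- r)))).
  by apply: ler_wpM2l => //; rewrite mulr_ge0.
apply: (@le_trans _ _ (2 * (N%:R / 4) * (N%:R^-1 * N%:R `^ (- r)))).
  by apply: ler_wpM2r; [rewrite mulr_ge0 ?invr_ge0 ?(ltW Np)|rewrite ler_pM2l].
rewrite le_eqVlt; apply/orP; left; apply/eqP.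
by move: (_ `^ _) => x; field; rewrite gt_eqF.
Qed.

(** Since [delta] is [1/2] scaled by [1 / sM], convexity gives [sm * cdelta delta <= (sm / sM) *
    cdelta (1/2) <= cdelta (1/2)]. *)
Lemma variance_factor_bound : Kl / N%:R <= cdelta (1 / 2) / (L * (1 + r)).
Proof.
have r1 : 0 < 1 + r by rewrite addr_gt0.
have h : sm * cdelta delta <= cdelta (1 / 2).
  apply: (@le_trans _ _ (sm * (sM^-1 * cdelta (1 / 2)))).
    rewrite ler_pM2l// (_ : delta = sM^-1 * (1 / 2)); last by rewrite /delta; field; rewrite gt_eqF.
    by apply: cdelta_scale; rewrite ?invr_ge0 ?(ltW sM0)// invf_le1.
  rewrite mulrA ler_piMl//; first by rewrite ltW// cdelta_gt0.
  by rewrite ler_pdivrMr// mul1r.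
rewrite ler_pdivrMr// mulrAC ler_pdivlMr ?mulr_gt0//.
rewrite (_ : Kl * (L * (1 + r)) = (1 + r) * Kl * L); last by ring.
by apply: le_trans hNc _; rewrite mulrC ler_pM2r.
Qed.

End SampleSize.

(** * Orthogonal projection and its residual *)

Section Projection.
Variables (R : realType) (d : nat) (K : set 'rV[R]_d).
Variables (p : probability (MeasRd R d) R) (lam : R) (n : nat) (l : 'I_n -> cylinder R d).
Hypotheses (cK : compact K) (pK : p (PK K) = 1%E) (lam0 : 0 <= lam).
Hypothesis orthoE : forall i j : 'I_n, L2ip K p (cyl_eval (l i)) (cyl_eval (l j)) = (i == j)%:R.
Variables (M : R) (F : MeasRd R d -> R).
Hypotheses (mF : measurable_fun (PK K) F) (hF : forall mu, PK K mu -> - M <= F mu <= M).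

Local Notation Ep := (Rintegral p [set: MeasRd R d]).
Local Notation chi := (chi K).
Local Notation PnF := (proj_coef K p l F).

Lemma chiF_bmf : bmf (fun mu => chi mu * F mu).
Proof.
have mPK := measurable_PK cK.
have E : (fun mu => chi mu * F mu) = F \_ (PK K).
  apply/funext => mu; rewrite patchE /chi indicE.
  by case: ifP => _; rewrite (mul1r, mul0r).
split; first by rewrite E; apply/(measurable_restrictT F mPK).
exists (`|M|) => mu; have [h|->] := chi_case K mu; last by rewrite mul0r normr0.
rewrite chi1// mul1r; have /andP[h1 h2] := hF h.
have := ler_norm M; rewrite ler_norml; lra.
Qed.

Definition resid mu := chi mu * (F mu - vn_eval l PnF mu).

Lemma resid_bmf : bmf resid.
Proof.
have b := vn_eval_bmf l PnF; have c := chi_bmf cK.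
apply: (bmf_ext (f := fun mu => chi mu * F mu - chi mu * vn_eval l PnF mu)).
  by move=> mu; rewrite /resid mulrBr.
by apply: bmfB; [exact: chiF_bmf|exact: bmfM].
Qed.

Lemma resid_ortho i : Ep (fun mu => resid mu * cyl_eval (l i) mu) = 0.
Proof.
have bl k := cyl_eval_bmf (l k); have c := chi_bmf cK.
transitivity (Ep (fun mu => chi mu * F mu * cyl_eval (l i) mu -
  \sum_k PnF k * (chi mu * (cyl_eval (l k) mu * cyl_eval (l i) mu)))).
  apply: eq_Rintegral => mu _; rewrite /resid /vn_eval mulrBr mulrBl; congr (_ - _).
  by rewrite mulr_sumr mulr_suml; apply: eq_bigr => k _; ring.
have bk k : bmf (fun mu => PnF k * (chi mu * (cyl_eval (l k) mu * cyl_eval (l i) mu))).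
  by apply: bmfZ; apply: bmfM => //; exact: bmfM.
rewrite RintB; [|by apply: bmfM => //; exact: chiF_bmf|exact: bmf_sum].
rewrite Rint_sum//.
rewrite (eq_bigr (fun k => PnF k * (k == i)%:R)); last first.
  move=> k _; rewrite RintZ; last by apply: bmfM => //; exact: bmfM.
  by rewrite -Rint_PK -orthoE.
rewrite (bigD1 i)//= eqxx mulr1 big1 ?addr0; last by move=> k /negPf ->; rewrite mulr0.
apply/eqP; rewrite subr_eq0 /proj_coef /L2ip Rint_PK; apply/eqP.
by apply: eq_Rintegral => mu _; rewrite mulrA.
Qed.

Definition proj_err := Ep (fun mu => resid mu ^+ 2).

Lemma proj_errE : Rintegral p (PK K) (fun mu => (vn_eval l PnF mu - F mu) ^+ 2) = proj_err.
Proof.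
rewrite Rint_PK; apply: eq_Rintegral => mu _.
by rewrite /resid exprMn chi_sqr -sqrrN opprB.
Qed.

(** Pythagoras: the residual is orthogonal to the span, and orthonormality turns the norm of the
    element of coefficients [u] into the Euclidean one. *)
Lemma L2_err_decomp u :
  Ep (fun mu => (resid mu - chi mu * vn_eval l u mu) ^+ 2) =
  proj_err + bform 1%:M (rowf u) (rowf u).
Proof.
have bl k := cyl_eval_bmf (l k); have c := chi_bmf cK; have br := resid_bmf.
have b1 i : bmf (fun mu => 2 * u i * (resid mu * cyl_eval (l i) mu)).
  by apply: bmfZ; exact: bmfM.
have b2 i k : bmf (fun mu => u i * u k * (chi mu * (cyl_eval (l i) mu * cyl_eval (l k) mu))).
  by apply: bmfZ; apply: bmfM => //; exact: bmfM.
transitivity (Ep (fun mu => resid mu ^+ 2 - \sum_i 2 * u i * (resid mu * cyl_eval (l i) mu) +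
   \sum_i \sum_k u i * u k * (chi mu * (cyl_eval (l i) mu * cyl_eval (l k) mu)))).
  apply: eq_Rintegral => mu _.
  rewrite sqrrB [(chi mu * vn_eval l u mu) ^+ 2]exprMn chi_sqr; congr (_ - _ + _).
    rewrite /vn_eval /resid !mulr_sumr -mulr_natl !mulr_sumr; apply: eq_bigr => i _.
    have cc := chi_sqr K mu; rewrite expr2 in cc.
    by rewrite mulrACA cc; ring.
  rewrite expr2 /vn_eval mulr_suml mulr_sumr; apply: eq_bigr => i _.
  by rewrite !mulr_sumr; apply: eq_bigr => k _; ring.
have bs1 : bmf (fun mu => \sum_i 2 * u i * (resid mu * cyl_eval (l i) mu)) by exact: bmf_sum.
have bs2 : bmf (fun mu => \sum_i \sum_k u i * u k * (chi mu * (cyl_eval (l i) mu * cyl_eval (l k) mu))).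
  by apply: bmf_sum => i; exact: bmf_sum.
have br2 : bmf (fun mu => resid mu ^+ 2) by exact: bmfX.
rewrite RintD//; last exact: bmfB.
rewrite RintB// Rint_sum// big1 ?subr0; last first.
  by move=> i _; rewrite RintZ ?resid_ortho ?mulr0//; exact: bmfM.
congr (_ + _); rewrite Rint_sum; last by move=> i; exact: bmf_sum.
rewrite bform1; apply: eq_bigr => i _; rewrite Rint_sum//.
rewrite (eq_bigr (fun k => u i * u k * (i == k)%:R)); last first.
  move=> k _; rewrite RintZ; last by apply: bmfM => //; exact: bmfM.
  by rewrite -Rint_PK -orthoE.
rewrite (bigD1 i)//= eqxx mulr1 big1 ?addr0; first by rewrite !mxE.
by move=> k; rewrite eq_sym => /negPf ->; rewrite mulr0.
Qed.

(** Pointwise on [PK K], the sum of the squares of the basis functions is at most [Klam], the energy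
    terms being nonnegative. *)
Lemma noise_second_moment :
  Ep (fun mu => \sum_i (resid mu * cyl_eval (l i) mu) ^+ 2) <= Klam K l lam * proj_err.
Proof.
have bl k := cyl_eval_bmf (l k); have br := resid_bmf.
rewrite -RintZ; last exact: bmfX.
apply: Rint_le; [by apply: bmf_sum => i; apply: bmfX; exact: bmfM|by apply: bmfZ; exact: bmfX|].
move=> mu; have [h|h] := chi_case K mu; last first.
  by rewrite big1 /resid ?h ?mul0r ?expr0n ?mulr0// => i _; rewrite !mul0r expr0n.
under eq_bigr do rewrite exprMn; rewrite -mulr_sumr mulrC ler_wpM2r ?sqr_ge0//.
apply: le_trans (trace_gram_le_Klam cK l lam h).
apply: ler_sum => i _; rewrite !mxE expr2 lerDl mulr_ge0//.
by have := psd_diag_ge0 i (psd_gramD cK l mu); rewrite mxE.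
Qed.

End Projection.

(** Truncation is the projection onto an interval that contains [x]. *)
Lemma clip_sqr_le (R : realType) (M x y : R) : - M <= x <= M ->
  (x - clip M y) ^+ 2 <= (x - y) ^+ 2.
Proof.
move=> /andP[h1 h2]; rewrite /clip.
case: (leP (- M) y) => h3; [case: (leP y M)|case: (leP (- M) M)] => h4; nra.
Qed.

Lemma clip_sqr_le_bound (R : realType) (M x y : R) : - M <= x <= M ->
  (x - clip M y) ^+ 2 <= 4 * M ^+ 2.
Proof.
move=> /andP[h1 h2]; rewrite /clip.
case: (leP (- M) y) => h3; [case: (leP y M)|case: (leP (- M) M)] => h4; nra.
Qed.

(** * Expectations of the empirical quantities *)

Section Sample.
Variables (R : realType) (d : nat) (K : set 'rV[R]_d).
Variables (p : probability (MeasRd R d) R) (lam : R) (n N : nat) (l : 'I_n -> cylinder R d).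
Variables (dO : measure_display) (Omega : measurableType dO) (P : probability Omega R).
Variables (mus : 'I_N -> Omega -> MeasRd R d) (M : R) (F : MeasRd R d -> R).
Hypotheses (cK : compact K) (pK : p (PK K) = 1%E) (lam0 : 0 <= lam) (N0 : (0 < N)%N).
Hypothesis orthoE : forall i j : 'I_n, L2ip K p (cyl_eval (l i)) (cyl_eval (l j)) = (i == j)%:R.
Hypothesis mmus : forall j, measurable_fun [set: Omega] (mus j).
Hypothesis iid : forall A : 'I_N -> set (MeasRd R d), (forall j, measurable (A j)) ->
  P [set w | forall j, A j (mus j w)] = (\prod_(j < N) fine (p (A j)))%:E.
Hypotheses (mF : measurable_fun (PK K) F) (hF : forall mu, PK K mu -> - M <= F mu <= M).

Local Notation EP := (Rintegral P [set: Omega]).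
Local Notation Ep := (Rintegral p [set: MeasRd R d]).
Local Notation chi := (chi K).
Local Notation PnF := (proj_coef K p l F).
Local Notation resid := (resid K p l F).

Definition noise w i := N%:R^-1 * \sum_j (resid (mus j w) * cyl_eval (l i) (mus j w)).

Definition emp_energy w :=
  N%:R^-1 * \sum_j chi (mus j w) * bform (gramD K l (mus j w)) (rowf PnF) (rowf PnF).

(** The number of sample points outside [PK K]: a measurable function of mean zero that is at least
    1 as soon as one point falls outside. It replaces an almost-sure restriction by a pointwise
    bound. *)
Definition off_PK w : R := \sum_j (1 - chi (mus j w)).

Let phi i mu := resid mu * cyl_eval (l i) mu.

Let bphi i : bmf (phi i).
Proof. by apply: bmfM; [exact: (resid_bmf p l cK mF hF)|exact: cyl_eval_bmf]. Qed.

Let bphi_mus i j : bmf (fun w => phi i (mus j w)).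
Proof. exact: (bmf_comp (g := phi i)). Qed.

Lemma noise_bmf : bmf (fun w => \sum_i noise w i ^+ 2).
Proof. by apply: bmf_sum => i; apply: bmfX; apply: bmfZ; apply: bmf_sum => j; exact: bphi_mus. Qed.

(** The products of the residual with the basis functions are centred by orthogonality, so the
    variance of the empirical mean carries the factor [1 / N]. *)
Lemma noise_expect : EP (fun w => \sum_i noise w i ^+ 2) <= Klam K l lam / N%:R * proj_err K p l F.
Proof.
have bs i : bmf (fun w => (\sum_j phi i (mus j w)) ^+ 2).
  by apply: bmfX; apply: bmf_sum => j; exact: bphi_mus.
rewrite (Rint_sum _ _ (F := fun i w => noise w i ^+ 2)); last first.
  by move=> i; apply: bmfX; apply: bmfZ; apply: bmf_sum => j; exact: bphi_mus.
have -> : \sum_i EP (fun w => noise w i ^+ 2) = N%:R^-1 * Ep (fun mu => \sum_i phi i mu ^+ 2).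
  rewrite Rint_sum; last by move=> i; exact: bmfX.
  rewrite mulr_sumr; apply: eq_bigr => i _.
  have -> : (fun w => noise w i ^+ 2) = fun w => N%:R ^- 2 * (\sum_j phi i (mus j w)) ^+ 2.
    by apply/funext => w; rewrite /noise exprMn exprVn.
  rewrite RintZ// (Rint_sum_sqr mmus iid (bphi i) (resid_ortho cK orthoE mF hF i)).
  by rewrite mulrA; congr (_ * _); field; rewrite pnatr_eq0 -lt0n.
rewrite [leRHS]mulrAC [leRHS]mulrC ler_wpM2l ?invr_ge0//.
exact: (noise_second_moment p l cK lam0 mF hF).
Qed.

Let bgD : bmf (fun mu => chi mu * bform (gramD K l mu) (rowf PnF) (rowf PnF)).
Proof. by apply: bmfM; [exact: chi_bmf|exact: bform_gramD_bmf]. Qed.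

Let bgD_mus j : bmf (fun w => chi (mus j w) * bform (gramD K l (mus j w)) (rowf PnF) (rowf PnF)).
Proof. exact: (bmf_comp (g := fun mu => chi mu * bform (gramD K l mu) (rowf PnF) (rowf PnF))). Qed.

Lemma emp_energy_bmf : bmf emp_energy.
Proof. by apply: bmfZ; apply: bmf_sum => j; exact: bgD_mus. Qed.

Lemma emp_energy_expect : EP emp_energy = pCE_p K p (vn_D l PnF) (vn_D l PnF).
Proof.
rewrite RintZ; last by apply: bmf_sum => j; exact: bgD_mus.
rewrite (Rint_sum _ _ (F := fun j w => chi (mus j w) *
  bform (gramD K l (mus j w)) (rowf PnF) (rowf PnF)))//.
under eq_bigr do rewrite (Rint_sample mmus iid _ bgD).
rewrite sumr_const card_ord -[X in _ * X]mulr_natl mulrA mulVf ?mul1r ?pnatr_eq0 -?lt0n//.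
rewrite /pCE_p Rint_PK; apply: eq_Rintegral => mu _.
by rewrite (bform_gramD cK).
Qed.

Lemma off_PK_bmf : bmf off_PK.
Proof.
apply: bmf_sum => j; apply: bmfB; first exact: bmf_cst.
by apply: (bmf_comp (g := chi)) => //; exact: chi_bmf.
Qed.

Lemma off_PK_expect : EP off_PK = 0.
Proof.
have bc j : bmf (fun w => chi (mus j w)).
  by apply: (bmf_comp (g := chi)) => //; exact: chi_bmf.
rewrite Rint_sum; last by move=> j; apply: bmfB => //; exact: bmf_cst.
rewrite big1// => j _; rewrite RintB//; last exact: bmf_cst.
by rewrite Rint_cst (Rint_sample mmus iid _ (chi_bmf cK)) (Ep_chi cK pK) subrr.
Qed.

Lemma off_PK_ge1 w j : ~ PK K (mus j w) -> 1 <= off_PK w.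
Proof.
move=> h; rewrite /off_PK (bigD1 j)//=.
have -> : chi (mus j w) = 0 by have [|//] := chi_case K (mus j w).
by rewrite subr0 lerDl sumr_ge0// => k _; rewrite subr_ge0 chi_le1.
Qed.

Lemma off_PK_ge0 w : 0 <= off_PK w.
Proof. by apply: sumr_ge0 => k _; rewrite subr_ge0 chi_le1. Qed.

End Sample.

(** * Deterministic error bound on the good event *)

Section GoodEvent.
Variables (R : realType) (d : nat) (K : set 'rV[R]_d).
Variables (p : probability (MeasRd R d) R) (lam : R) (n N : nat) (l : 'I_n -> cylinder R d).
Variables (dO : measure_display) (Omega : measurableType dO).
Variables (mus : 'I_N -> Omega -> MeasRd R d) (F : MeasRd R d -> R).
Hypotheses (cK : compact K) (lam0 : 0 <= lam) (n0 : (0 < n)%N) (N0 : (0 < N)%N).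

Lemma good_event_error (w : Omega) (c u : 'I_n -> R) :
  (forall i, c i = proj_coef K p l F i + 1 * u i) ->
  (forall c', L2_emp (fun j => mus j w) F (vn_eval l c)
        + lam * pCE_emp K (fun j => mus j w) (vn_D l c)
      <= L2_emp (fun j => mus j w) F (vn_eval l c')
        + lam * pCE_emp K (fun j => mus j w) (vn_D l c')) ->
  (forall j, PK K (mus j w)) ->
  (forall v : 'rV[R]_n, N%:R * (1 - 1 / (2 * smax K p lam l)) * bform 1%:M v v <=
     bform (\sum_(j < N) ngram K p lam l (mus j w)) v v) ->
  bform 1%:M (rowf u) (rowf u) <=
    2 * (\sum_i noise K p l mus F w i ^+ 2) / (1 / 2 + lam * mu_min K p l) ^+ 2
    + 4 * (lam * emp_energy K p l mus F w).
Proof.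
move=> cE cmin hPK hgood; set s := 1 / 2 + _.
have Np : 0 < N%:R :> R by rewrite ltr0n.
have chij j : chi K (mus j w) = 1 by exact: chi1.
pose H : 'M[R]_n := N%:R^-1 *: \sum_(j < N) gram K lam l (mus j w).
pose A : 'M[R]_n := N%:R^-1 *: \sum_(j < N) gramD K l (mus j w).
pose eta : 'rV[R]_n := \row_i noise K p l mus F w i.
have HE x y : bform H x y = N%:R^-1 * \sum_(j < N) bform (gram K lam l (mus j w)) x y.
  by rewrite bformMZ bform_sum.
have AE x y : bform A x y = N%:R^-1 * \sum_(j < N) bform (gramD K l (mus j w)) x y.
  by rewrite bformMZ bform_sum.
have -> : \sum_i noise K p l mus F w i ^+ 2 = bform 1%:M eta eta.
  by rewrite bform1; apply: eq_bigr => i _; rewrite mxE expr2.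
have -> : emp_energy K p l mus F w = bform A (rowf (proj_coef K p l F)) (rowf (proj_coef K p l F)).
  by rewrite AE /emp_energy; congr (_ * _); apply: eq_bigr => j _; rewrite chij mul1r.
have pA : psd A.
  by apply: psdZ; [rewrite invr_ge0 ltW|apply: psd_sum => j _; exact: psd_gramD].
apply: (@ls_error _ _ H) => //.
- by rewrite lerDl mulr_ge0// mu_min_ge0.
(* This [v] undoes the normalisation of [ngram]. Coordinatewise, [(1 - 1 / (2 smax)) * sigma i >=
   sigma i - 1/2 >= 1/2 + lam * mu_min]. *)
- pose v : 'rV[R]_n := \row_i (Num.sqrt (sigma K p lam l i) * u i).
  have := hgood v.
  have -> : bform (\sum_(j < N) ngram K p lam l (mus j w)) v v = N%:R * bform H (rowf u) (rowf u).
    rewrite HE mulrA divff ?gt_eqF// mul1r bform_sum; apply: eq_bigr => j _.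
    rewrite bform_ngram chij mul1r; congr (bform _ _ _); apply/rowP => i;
      by rewrite !mxE mulrAC divff ?mul1r// gt_eqF// sqrt_sigma_gt0.
  rewrite -mulrA ler_pM2l//; apply: le_trans.
  rewrite !bform1 !mulr_sumr; apply: ler_sum => i _; rewrite !mxE mulrACA -!expr2.
  rewrite sqr_sqrtr ?(ltW (sigma_gt0 K p l lam0 i))// [leRHS]mulrA ler_wpM2r ?sqr_ge0//.
  have sM0 : 0 < smax K p lam l.
    by apply: lt_le_trans (smax_ge K p l lam0 (Ordinal n0)); exact: sigma_gt0.
  have h1 : sigma K p lam l i / (2 * smax K p lam l) <= 1 / 2.
    by rewrite ler_pdivrMr ?mulr_gt0// mul1r mulrA mulVf// mul1r smax_ge.
  have h2 : 1 + lam * mu_min K p l <= sigma K p lam l i by exact: smin_le.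
  rewrite mulrBl !mul1r [X in _ - X]mulrC /s; move: h1 h2.
  move: (sigma _ _ _ _ _) (smax _ _ _ _) (lam * _) => x y z; lra.
- rewrite AE HE mulrCA ler_wpM2l ?invr_ge0// mulr_sumr; apply: ler_sum => j _.
  by rewrite /gram bformMD bformMZ lerDr (psd_gramE l (mus j w)).2.
- have := ls_minimizer_ineq cK cE cmin; rewrite HE AE => /le_trans; apply.
  rewrite le_eqVlt; apply/orP; left; apply/eqP; congr (_ - _).
  rewrite bform1 mulr_sumr.
  under eq_bigr do rewrite /vn_eval -/(vn_eval l _ _) mulr_sumr mulr_sumr.
  rewrite exchange_big; apply: eq_bigr => i _; rewrite !mxE /noise -mulrA mulr_suml mulr_sumr.
  apply: eq_bigr => j _; rewrite /resid chij mul1r; congr (_ * _).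
  by rewrite [u i * _]mulrC mulrA.
Qed.

End GoodEvent.

Unset Implicit Arguments.

Theorem theorem4p13 (R : realType) (d : nat) (K : set 'rV[R]_d)
  (p : probability (MeasRd R d) R) (lam : R) (n N : nat)
  (l : 'I_n -> cylinder R d)
  (dO : measure_display) (Omega : measurableType dO) (P : probability Omega R)
  (mus : 'I_N -> Omega -> MeasRd R d)
  (M : R) (F : MeasRd R d -> R) (cS : Omega -> 'I_n -> R) (r : R) :
  compact K ->
  p (PK K) = 1%E ->
  0 <= lam ->
  (0 < n)%N ->
  (forall i j : 'I_n,
      L2ip K p (cyl_eval (l i)) (cyl_eval (l j)) = (i == j)%:R) ->
  (forall i j : 'I_n, i != j ->
      pCE_p K p (cyl_D (l i)) (cyl_D (l j)) = 0) ->
  (forall j, measurable_fun [set: Omega] (mus j)) ->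
  (forall A : 'I_N -> set (MeasRd R d), (forall j, measurable (A j)) ->
      P [set w | forall j, A j (mus j w)] = (\prod_(j < N) fine (p (A j)))%:E) ->
  0 < M ->
  measurable_fun (PK K) F ->
  (forall mu, PK K mu -> - M <= F mu <= M) ->
  (forall (w : Omega) (c : 'I_n -> R),
      L2_emp (fun j => mus j w) F (vn_eval l (cS w))
        + lam * pCE_emp K (fun j => mus j w) (vn_D l (cS w))
      <= L2_emp (fun j => mus j w) F (vn_eval l c)
        + lam * pCE_emp K (fun j => mus j w) (vn_D l c)) ->
  0 < r ->
  (2 <= N)%N ->
  let mu_min := inf (range (fun i => pCE_p K p (cyl_D (l i)) (cyl_D (l i)))) in
  let mu_max := sup (range (fun i => pCE_p K p (cyl_D (l i)) (cyl_D (l i)))) in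
  let sigma_min := 1 + lam * mu_min in
  let sigma_max := 1 + lam * mu_max in
  N%:R / ln N%:R >= (1 + r) * Klam K l lam
                    / (sigma_min * cdelta (1 / (2 * sigma_max))) ->
  let PnF := proj_coef K p l F in
  let e := Rintegral p (PK K) (fun mu => (vn_eval l PnF mu - F mu) ^+ 2) in
  (\int[P]_w (\int[p]_(mu in PK K)
        ((F mu - clip M (vn_eval l (cS w) mu)) ^+ 2)%:E) <=
   (2 * e * (1 + cdelta (1 / 2)
                / (ln N%:R * (1 + r) * (1 / 2 + lam * mu_min) ^+ 2))
    + 4 * lam * pCE_p K p (vn_D l PnF) (vn_D l PnF)
    + 2 * M ^+ 2 * (N%:R `^ (- r)))%:E)%E.
Proof.
move=> cK pK lam0 n0 orthoE orthoD mmus iid M0 mF hF cmin r0 N2; cbv zeta => hN.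
have N0 : (0 < N)%N by apply: leq_trans N2.
have sm1 := smin_ge1 K p l lam0 n0.
have smM := smin_smax K p l lam0 n0.
have nK := Klam_ge cK pK lam0 orthoE orthoD.
have K0 := Klam_gt0 cK pK lam0 n0 orthoE orthoD.
have [Z [bZ Z0 EZ hZ]] := matrix_chernoff mmus iid (ngram_bmf p lam l cK) (psd_ngram p l cK lam0)
  (psd_ngram_bound cK pK lam0 n0 orthoE orthoD) (Klam_smin_ge1 cK pK lam0 n0 orthoE orthoD)
  (Ep_ngram cK lam0 orthoE orthoD) N0 (delta_gt0 sm1 smM) (delta_le_half sm1 smM).
have {}EZ := le_trans EZ (bad_event_bound N2 sm1 smM nK K0 r0 hN).
have vfac := variance_factor_bound N2 sm1 smM r0 hN.
have noiseE := noise_expect cK lam0 N0 orthoE mmus iid mF hF.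
have noiseB := noise_bmf (N := N) p l cK mmus mF hF.
rewrite proj_errE.
set s := 1 / 2 + lam * inf _.
set e0 := proj_err K p l F in noiseE *.
set al := fun w : Omega => _ in noiseB noiseE.
pose be := emp_energy K p l mus F.
pose off := off_PK K mus.
have bbe : bmf be by exact: emp_energy_bmf.
have boff : bmf off by exact: off_PK_bmf.
have Ebe : Rintegral P [set: Omega] be = _ := emp_energy_expect l F cK N0 mmus iid.
have Eoff : Rintegral P [set: Omega] off = 0 := off_PK_expect cK pK mmus iid.
have e00 : 0 <= e0 by apply: Rintegral_ge0 => mu _; exact: sqr_ge0.
(* The majorant: [e0] plus the bound on [|u|^2] valid on the good event, plus the trivial bound
   [4 M^2], switched on by [Z] or [off]. *)
pose U w := e0 + (2 / s ^+ 2 * al w + (4 * lam * be w + 4 * M ^+ 2 * (Z w + off w))).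
have bU : bmf U.
  apply: bmfD; first exact: bmf_cst.
  apply: bmfD; first exact: bmfZ.
  by apply: bmfD; apply: bmfZ => //; exact: bmfD.
have al0 w : 0 <= al w by apply: sumr_ge0 => i _; exact: sqr_ge0.
have be0 w : 0 <= be w.
  rewrite mulr_ge0 ?invr_ge0// sumr_ge0// => j _.
  by rewrite mulr_ge0 ?chi_ge0// (psd_gramD cK l _).2.
have off0 w : 0 <= off w by exact: off_PK_ge0.
have s0 : 0 < s.
  by apply: ltr_wpDr; [apply: mulr_ge0 => //; exact: mu_min_ge0|].
have M20 : 0 <= 4 * M ^+ 2 by rewrite mulr_ge0// sqr_ge0.
apply: (@le_trans _ _ (Rintegral P [set: Omega] U)%:E); last first.
  rewrite lee_fin RintD; [|exact: bmf_cst|by do 2 (apply: bmfD; [exact: bmfZ|]); apply: bmfZ; exact: bmfD].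
  rewrite RintD; [|exact: bmfZ|by apply: bmfD; apply: bmfZ => //; exact: bmfD].
  rewrite RintD; [|exact: bmfZ|by apply: bmfZ; exact: bmfD].
  rewrite (RintZ P (2 / s ^+ 2) noiseB) (RintZ P (4 * lam) bbe).
  rewrite (RintZ P (4 * M ^+ 2) (bmfD bZ boff)) (RintD P bZ boff).
  rewrite Rint_cst Eoff addr0.
  rewrite Ebe.
  have h1 : 2 / s ^+ 2 * Rintegral P [set: Omega] al <=
      2 / s ^+ 2 * (cdelta (1 / 2) / (ln N%:R * (1 + r)) * e0).
    apply: ler_wpM2l; first by rewrite divr_ge0// sqr_ge0.
    by apply: le_trans noiseE _; exact: ler_wpM2r.
  (* [4 M^2] times [N^(-r) / 2] is the last term of the claim. The term [e0] of [U] is bounded by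
     the [2 * e0] on the right. *)
  have h2 := ler_wpM2l M20 EZ.
  have -> : 2 * e0 * (1 + cdelta (1 / 2) / (ln N%:R * (1 + r) * s ^+ 2)) =
      2 * e0 + 2 / s ^+ 2 * (cdelta (1 / 2) / (ln N%:R * (1 + r)) * e0).
    by rewrite !invfM; ring.
  move: h1 h2 e00; rewrite -/e0.
  move: (Rintegral _ _ al) (Rintegral _ _ Z) (pCE_p _ _ _ _) (cdelta _ / _) (N%:R `^ _) (2 / _) => x1 x2 x3 x4 x5 x6.
  move=> h1 h2 h3; lra.
(* From here on [w] is fixed: [le_integral_bmf] asks for no measurability of the inner integral in
   [w], only for a bound by [U w]. *)
apply: le_integral_bmf => // w; first by apply: integral_ge0 => mu _; rewrite lee_fin sqr_ge0.
have inner g : bmf g -> (forall mu, 0 <= g mu) ->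
    (forall mu, PK K mu -> (F mu - clip M (vn_eval l (cS w) mu)) ^+ 2 <= g mu) ->
    (\int[p]_(mu in PK K) ((F mu - clip M (vn_eval l (cS w) mu)) ^+ 2)%:E <=
      (Rintegral p [set: MeasRd R d] g)%:E)%E.
  move=> bg g0 hg; rewrite integral_mkcond; apply: le_integral_bmf => // mu.
    by apply: erestrict_ge0 => nu _; rewrite lee_fin sqr_ge0.
  by rewrite patchE; case: ifPn => [/set_mem h|_]; rewrite lee_fin// hg.
have crude : 1 <= Z w + off w ->
    (\int[p]_(mu in PK K) ((F mu - clip M (vn_eval l (cS w) mu)) ^+ 2)%:E <= (U w)%:E)%E.
  move=> h; apply: (le_trans (inner (fun=> 4 * M ^+ 2) _ _ _)) => //.
  - exact: bmf_cst.
  - by move=> mu h'; apply: clip_sqr_le_bound; exact: hF.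
  - rewrite Rint_cst lee_fin /U.
    have t1 : 0 <= 2 / s ^+ 2 * al w by rewrite mulr_ge0// divr_ge0// sqr_ge0.
    have t2 : 0 <= 4 * lam * be w by rewrite mulr_ge0// mulr_ge0.
    have t3 := ler_wpM2l M20 h; rewrite mulr1 in t3.
    by apply: (le_trans t3); rewrite addrA addrA lerDr !addr_ge0.
have [hPK|/existsNP[j hj]] := pselect (forall j, PK K (mus j w)); last first.
  by apply: crude; apply: ler_wpDl => //; exact: (off_PK_ge1 hj).
have [[v hv]|hgood] := pselect (exists v : 'rV[R]_n,
    bform (\sum_(j < N) ngram K p lam l (mus j w)) v v <
      N%:R * (1 - 1 / (2 * smax K p lam l)) * bform 1%:M v v).
  by apply: crude; apply: ler_wpDr => //; exact: hZ hv.
(* Both bad events are excluded: the sample lies in [PK K] and no direction [v] violates the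
   Chernoff bound, so the deterministic estimate applies at this [w]. *)
pose u i := cS w i - proj_coef K p l F i.
have cE i : cS w i = proj_coef K p l F i + 1 * u i by rewrite /u mul1r addrC subrK.
have err := good_event_error cK lam0 n0 N0 cE (cmin w) hPK.
have {}err : bform 1%:M (rowf u) (rowf u) <= 2 / s ^+ 2 * al w + 4 * lam * be w.
  rewrite [2 / _ * _]mulrAC -[4 * lam * _]mulrA; apply: err => v.
  by rewrite leNgt; apply/negP => hv; apply: hgood; exists v.
pose g mu := (resid K p l F mu - chi K mu * vn_eval l u mu) ^+ 2.
have bg : bmf g.
  apply: bmfX; apply: bmfB; first exact: (resid_bmf p l cK mF hF).
  by apply: bmfM; [exact: chi_bmf|exact: vn_eval_bmf].
apply: (le_trans (inner g bg _ _)).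
- by move=> mu; exact: sqr_ge0.
- move=> mu h; apply: (le_trans (clip_sqr_le (vn_eval l (cS w) mu) (hF mu h))).
  rewrite /g /resid chi1// !mul1r.
  have -> : vn_eval l (cS w) mu = vn_eval l (proj_coef K p l F) mu + 1 * vn_eval l u mu.
    by rewrite -vn_eval_lin; congr (vn_eval l _ mu); apply/funext.
  by rewrite mul1r opprD addrA.
- rewrite (L2_err_decomp cK orthoE mF hF) lee_fin /U -/e0 lerD2l.
  apply: (le_trans err); rewrite lerD2l lerDl mulr_ge0// addr_ge0//.
Qed.
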